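(* Consider the two-step symmetric methods M2, M3, M4 (defined in the context), with step size $h$, applied to the relativistic charged-particle system $$\frac{dx}{d\tau}=v,\qquad \frac{dt}{d\tau}=w,\qquad \frac{dv}{d\tau}=v\times B(x)-i\,w\,E(x),\qquad \frac{dw}{d\tau}=i\,E(x)\cdot v,$$ where $E=-\nabla U$ with a quadratic potential $U(x)=\frac12x^{\intercal}Qx+q^{\intercal}x$, $Q$ being a symmetric matrix. Assume that the numerical solution remains within a compact set independent of $h$. Then, for each of the methods M2, M3, M4, the energy $H(x,\gamma)=\gamma+U(x)$ is nearly preserved: $$|H(x_n,\gamma_n)-H(x_0,\gamma_0)|\le Ch^2\qquad\text{for } nh\le h^{-N+2},$$ where $N\ge3$ is an (arbitrary fixed integer) truncation number, $\gamma_n=-i\,w_n$, and $C$ is a constant independent of $n$ and $h$, but depending on $N$.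
   Context: **System.** $A:\mathbb{R}^3\to\mathbb{R}^3$ and $U:\mathbb{R}^3\to\mathbb{R}$ are smooth, $B=\nabla\times A$, $E=-\nabla U$. The unknowns are $x(\tau),v(\tau)\in\mathbb{R}^3$ and purely imaginary scalars $t(\tau),w(\tau)\in i\mathbb{R}$ (with $t=i\bar t$, $w=i\gamma$, where $\bar t$ is time and $\gamma$ the relativistic factor, $\gamma=\sqrt{1+v^{\intercal}v}$ for the physical solution; $\tau$ is the proper time). The numerical relativistic factor $\gamma_n$ is defined by $w_n=i\gamma_n$. **Matrices.** For $b\in\mathbb{R}^3$ let $\tilde b$ be the skew-symmetric $3\times3$ matrix with $\tilde b\,\alpha=\alpha\times b$ for all $\alpha\in\mathbb{R}^3$; thus $\tilde B(x)$, $\tilde E(x)$ are the matrices associated with $B(x)$, $E(x)$. Let $${\bm F}(x)=\begin{pmatrix}\tilde B(x)&-iE(x)\\ iE(x)^{\intercal}&0\end{pmatrix}\in\mathbb{C}^{4\times4}.$$ **Coefficients.** Let $r_1=E^{\intercal}E-B^{\intercal}B$, $r_2=-E^{\intercal}B$, $d=\sqrt{r_1^2+4r_2^2}$, $\lambda_1=(r_1+d)/2$, $\lambda_2=(r_1-d)/2$ (all functions of $x$), and, with $k=h/2$, $$K_1=\frac{\sqrt{\lambda_1}\tanh(k\sqrt{\lambda_1})-\sqrt{\lambda_2}\tanh(k\sqrt{\lambda_2})}{d},\qquad K_2=\frac{r_2}{d}\Big(\frac{\tanh(k\sqrt{\lambda_1})}{\sqrt{\lambda_1}}-\frac{\tanh(k\sqrt{\lambda_2})}{\sqrt{\lambda_2}}\Big),$$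 $$K_3=\tfrac12\Big(1-\frac{r_1}{d}\Big)\operatorname{sech}(k\sqrt{\lambda_1})+\tfrac12\Big(1+\frac{r_1}{d}\Big)\operatorname{sech}(k\sqrt{\lambda_2}),\qquad K_4=\frac{\operatorname{sech}(k\sqrt{\lambda_1})-\operatorname{sech}(k\sqrt{\lambda_2})}{d},$$ removable singularities being filled in by continuity (i.e. by the corresponding power series in $h$). These are such that $\tanh(\frac h2{\bm F})=K_1{\bm F}+K_2\hat{\bm F}$ with $\hat{\bm F}=\begin{pmatrix}\tilde E&iB\\-iB^{\intercal}&0\end{pmatrix}$, and $\operatorname{sech}(\frac h2{\bm F})=K_3{\bm I}+K_4{\bm F}^2$. Write $S_j=K_j(x_0)$ for $j=1,\dots,4$, and $B_0=B(x_0)$. **Abbreviations.** $\delta^2x_n=\frac{x_{n+1}-2x_n+x_{n-1}}{h^2}$, $\delta x_n=\frac{x_{n+1}-x_{n-1}}{2h}$, and similarly $\delta^2t_n$, $\delta t_n$. All methods start from initial values $(x_0;t_0)$, $(v_0;w_0)$ and the starting value $(x_1;t_1)=(x_0;t_0)+h\,e^{\frac h2{\bm F}(x_0)}(v_0;w_0)$; the two-step recursions and momentum formulas below are used for $n\ge1$. **M2.** $$\delta^2x_n=\tfrac2h\big(S_1\tilde B(x_n)+S_2\tilde E(x_n)\big)\delta x_n-\tfrac{2i}{h}\big(S_1E(x_n)-S_2B_0\big)\delta t_n,\qquad \delta^2t_n=\tfrac{2i}{h}\big(S_1E(x_n)^{\intercal}-S_2B_0^{\intercal}\big)\delta x_n,$$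 with momentum $$v_n=\big(S_3I+S_4(\tilde B(x_n)^2+E(x_n)E(x_n)^{\intercal})\big)\delta x_n-iS_4\tilde B(x_n)E(x_n)\,\delta t_n,$$ $$w_n=iS_4E(x_n)^{\intercal}\tilde B(x_n)\,\delta x_n+\big(S_3+S_4E(x_n)^{\intercal}E(x_n)\big)\delta t_n.$$ **M3.** $\delta^2x_n=\tfrac2hS_1\big(\tilde B(x_n)\delta x_n-iE(x_n)\delta t_n\big)$, $\ \delta^2t_n=\tfrac{2i}{h}S_1E(x_n)^{\intercal}\delta x_n$, with momentum $v_n=S_3\,\delta x_n$, $w_n=S_3\,\delta t_n$. **M4.** $\delta^2x_n=\tilde B(x_n)\delta x_n-iE(x_n)\delta t_n$, $\ \delta^2t_n=iE(x_n)^{\intercal}\delta x_n$, with momentum $v_n=\delta x_n$, $w_n=\delta t_n$. *)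

(* Defs.v *)
From HB Require Import structures.
From mathcomp Require Import all_boot all_order all_algebra.
From mathcomp Require Import all_classical all_reals all_analysis.
From mathcomp Require Import complex ring.

Set Implicit Arguments.
Unset Strict Implicit.
Unset Printing Implicit Defensive.

Import Order.TTheory GRing.Theory Num.Theory.
Import numFieldNormedType.Exports.

Local Open Scope classical_set_scope.
Local Open Scope ring_scope.
Local Open Scope complex_scope.

Section VectorCalculus.
Context {R : realType}.
Implicit Types (a b x : 'cV[R]_3).

Definition ax (j : 'I_3) : 'cV[R]_3 := delta_mx j 0.

Definition partial (j : 'I_3) (f : 'cV[R]_3 -> R) (x : 'cV[R]_3) : R :=
  'D_(ax j) f x.

Fixpoint Ck (k : nat) (f : 'cV[R]_3 -> R) : Prop :=
  if k is k'.+1 then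
    [/\ continuous f, (forall j x, derivable f x (ax j)) &
        forall j, Ck k' (partial j f)]
  else continuous f.

Definition smooth (A : 'cV[R]_3 -> 'cV[R]_3) : Prop :=
  forall (i : 'I_3) (k : nat), Ck k (fun x => A x i 0).

Definition vec3 (c0 c1 c2 : R) : 'cV[R]_3 :=
  \col_(i < 3) [:: c0; c1; c2]`_i.

Definition i0 : 'I_3 := @Ordinal 3 0 isT.
Definition i1 : 'I_3 := @Ordinal 3 1 isT.
Definition i2 : 'I_3 := @Ordinal 3 2 isT.

Definition curl (A : 'cV[R]_3 -> 'cV[R]_3) (x : 'cV[R]_3) : 'cV[R]_3 :=
  let pd j i := partial j (fun y => A y i 0) x in
  vec3 (pd i1 i2 - pd i2 i1) (pd i2 i0 - pd i0 i2) (pd i0 i1 - pd i1 i0).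

Definition grad (U : 'cV[R]_3 -> R) (x : 'cV[R]_3) : 'cV[R]_3 :=
  \col_(j < 3) partial j U x.

Definition cross a b : 'cV[R]_3 :=
  vec3 (a i1 0 * b i2 0 - a i2 0 * b i1 0)
       (a i2 0 * b i0 0 - a i0 0 * b i2 0)
       (a i0 0 * b i1 0 - a i1 0 * b i0 0).

(* Column j is e_j x b, so that tilde b *m a = a x b (tildeE below). *)
Definition tilde b : 'M[R]_3 := \matrix_(i, j) cross (ax j) b i 0.

Lemma tildeE a b : tilde b *m a = cross a b.
Proof.
have E0 : ord0 = i0 by apply/val_inj.
have E1 : lift i0 ord0 = i1 by apply/val_inj.
have E2 : lift i0 (lift ord0 ord0) = i2 by apply/val_inj.
apply/matrixP => i j; rewrite (ord1 j) !mxE !big_ord_recl big_ord0 E0 E1 E2.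
rewrite !mxE /=.
case: i => -[|[|[|//]]] /= ?; ring.
Qed.

Definition dot a b : R := (a^T *m b) 0 0.

End VectorCalculus.

Section Complex.
Context {R : realType}.
Local Notation C := R[i].

Definition toC {m n : nat} (M : 'M[R]_(m, n)) : 'M[C]_(m, n) :=
  map_mx (fun a : R => a%:C) M.

Definition expC (z : C) : C :=
  (expR (complex.Re z))%:C *
    (cos (complex.Im z) +i* sin (complex.Im z)).

Definition coshC (z : C) : C := (expC z + expC (- z)) / 2.
Definition sinhC (z : C) : C := (expC z - expC (- z)) / 2.
Definition tanhC (z : C) : C := sinhC z / coshC z.
Definition sechC (z : C) : C := (coshC z)^-1.

(* Matrix exponential: the entrywise limit of the partial sums of
   \sum_k M ^ k / k`!, taken on real and imaginary parts. *)
Definition expmx {n : nat} (M : 'M[C]_n) : 'M[C]_n :=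
  let psum (m : nat) : 'M[C]_n := \sum_(k < m) (k`!%:R)^-1 *: M ^+ k in
  \matrix_(i, j)
    (limn (fun m => complex.Re (psum m i j) : R) +i*
     limn (fun m => complex.Im (psum m i j) : R)).

End Complex.

Section Coefficients.
Context {R : realType}.
Local Notation C := R[i].

(* E and B are the values of the fields at one point, and h is the step size.
   sqrtc is the principal square root: the second eigenvalue is nonpositive,
   and all the expressions in it are even, hence independent of the branch.

   Removable singularities, with k = h / 2: as l -> 0,
     tanh (k sqrt l) / sqrt l    = k - k^3 l / 3 + O(l^2),
     sqrt l * tanh (k sqrt l)    = k l + O(l^2),
     sech (k sqrt l)             = 1 - k^2 l / 2 + O(l^2),
   and d = lambda1 - lambda2 vanishes only if r1 = r2 = 0, that is,
   lambda1 = lambda2 = 0; there K1 -> k, K2 -> 0, K3 -> 1, K4 -> - k^2 / 2. *)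
Context (h : R) (E B : 'cV[R]_3).

Definition r1 : R := dot E E - dot B B.
Definition r2 : R := - dot E B.
Definition dd : R := Num.sqrt (r1 ^+ 2 + 4 * r2 ^+ 2).
Definition lambda1 : R := (r1 + dd) / 2.
Definition lambda2 : R := (r1 - dd) / 2.

Local Notation k := (h / 2).

Definition sqrt_tanh (l : R) : C :=
  sqrtc l%:C * tanhC (k%:C * sqrtc l%:C).
Definition tanh_div_sqrt (l : R) : C :=
  if l == 0 then k%:C else tanhC (k%:C * sqrtc l%:C) / sqrtc l%:C.
Definition sech_sqrt (l : R) : C := sechC (k%:C * sqrtc l%:C).

Definition K1 : C :=
  if dd == 0 then k%:C else (sqrt_tanh lambda1 - sqrt_tanh lambda2) / dd%:C.

Definition K2 : C :=
  if dd == 0 then 0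
  else (r2 / dd)%:C * (tanh_div_sqrt lambda1 - tanh_div_sqrt lambda2).

Definition K3 : C :=
  if dd == 0 then 1
  else 2^-1 * (1 - r1 / dd)%:C * sech_sqrt lambda1
       + 2^-1 * (1 + r1 / dd)%:C * sech_sqrt lambda2.

Definition K4 : C :=
  if dd == 0 then - (k ^+ 2 / 2)%:C
  else (sech_sqrt lambda1 - sech_sqrt lambda2) / dd%:C.

End Coefficients.

Section Methods.
Context {R : realType}.
Local Notation C := R[i].

Definition diff2 {V : lmodType C} (h : R) (y : nat -> V) (n : nat) : V :=
  ((h ^+ 2)%:C)^-1 *: (y n.+1 - 2 *: y n + y n.-1).
Definition diff1 {V : lmodType C} (h : R) (y : nat -> V) (n : nat) : V :=
  ((2 * h)%:C)^-1 *: (y n.+1 - y n.-1).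

Variant method := M2 | M3 | M4.

(* Fields as functions of the position; E0, B0 are their values at x 0. *)
Context (E B : 'cV[R]_3 -> 'cV[R]_3).

Definition Fmx (y : 'cV[R]_3) : 'M[C]_(3 + 1) :=
  block_mx (toC (tilde (B y))) (- 'i *: toC (E y))
           ('i *: (toC (E y))^T) 0.

(* (u; s) for a real 3-vector u and a complex scalar s *)
Definition pair4 (u : 'cV[R]_3) (s : C) : 'cV[C]_(3 + 1) :=
  col_mx (toC u) s%:M.

Context (h : R) (x v : nat -> 'cV[R]_3) (t w : nat -> C).

Local Notation S1 := (K1 h (E (x 0%N)) (B (x 0%N))).
Local Notation S2 := (K2 h (E (x 0%N)) (B (x 0%N))).
Local Notation S3 := (K3 h (E (x 0%N)) (B (x 0%N))).
Local Notation S4 := (K4 h (E (x 0%N)) (B (x 0%N))).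
Local Notation B0 := (toC (B (x 0%N))).
Local Notation En n := (toC (E (x n))).
Local Notation tB n := (toC (tilde (B (x n)))).
Local Notation tE n := (toC (tilde (E (x n)))).
Local Notation xC := (fun n => toC (x n)).
Local Notation tC := (t : nat -> C^o).
Local Notation d1x n := (diff1 h xC n).
Local Notation d2x n := (diff2 h xC n).
Local Notation d1t n := (diff1 h tC n : C).
Local Notation d2t n := (diff2 h tC n : C).
Local Notation hC := (h%:C).

(* A product of a row and a column is a 1 x 1 matrix; its entry is the scalar. *)
Local Notation scal M := (M 0 0).

Definition recursion (m : method) (n : nat) : Prop :=
  match m with
  | M2 =>
      d2x n = (2 / hC) *: ((S1 *: tB n + S2 *: tE n) *m d1x n)
              - (2 * 'i / hC * d1t n) *: (S1 *: En n - S2 *: B0)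
      /\ d2t n = 2 * 'i / hC
                 * scal ((S1 *: (En n)^T - S2 *: B0^T) *m d1x n)
  | M3 =>
      d2x n = (2 / hC * S1) *: (tB n *m d1x n - ('i * d1t n) *: En n)
      /\ d2t n = 2 * 'i / hC * S1 * scal ((En n)^T *m d1x n)
  | M4 =>
      d2x n = tB n *m d1x n - ('i * d1t n) *: En n
      /\ d2t n = 'i * scal ((En n)^T *m d1x n)
  end.

Definition momentum (m : method) (n : nat) : Prop :=
  match m with
  | M2 =>
      toC (v n) =
        (S3%:M + S4 *: (tB n *m tB n + En n *m (En n)^T)) *m d1x n
        - ('i * S4 * d1t n) *: (tB n *m En n)
      /\ w n = 'i * S4 * scal ((En n)^T *m tB n *m d1x n)
               + (S3 + S4 * scal ((En n)^T *m En n)) * d1t n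
  | M3 => toC (v n) = S3 *: d1x n /\ w n = S3 * d1t n
  | M4 => toC (v n) = d1x n /\ w n = d1t n
  end.

Definition starting_value : Prop :=
  pair4 (x 1%N) (t 1%N) =
  pair4 (x 0%N) (t 0%N)
  + hC *: (expmx ((h / 2)%:C *: Fmx (x 0%N)) *m pair4 (v 0%N) (w 0%N)).

(* The numerical solution is only required to exist up to time T. *)
Definition numerical_solution (m : method) (T : R) : Prop :=
  starting_value /\
  forall n : nat, (1 <= n)%N -> n%:R * h <= T -> recursion m n /\ momentum m n.

End Methods.

Definition quadratic_potential {R : realType} (Q : 'M[R]_3) (q : 'cV[R]_3)
  (x : 'cV[R]_3) : R := 2^-1 * (x^T *m Q *m x) 0 0 + (q^T *m x) 0 0.

Definition energy {R : realType} (U : 'cV[R]_3 -> R) (x : 'cV[R]_3)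
  (gamma : R) : R := gamma + U x.

(* Main.v *)
Require Import Defs.
From HB Require Import structures.
From mathcomp Require Import all_boot all_order all_algebra.
From mathcomp Require Import all_classical all_reals all_analysis.
From mathcomp Require Import complex ring lra.

Set Implicit Arguments.
Unset Strict Implicit.
Unset Printing Implicit Defensive.

Import Order.TTheory GRing.Theory Num.Theory.
Import numFieldNormedType.Exports.

Local Open Scope classical_set_scope.
Local Open Scope ring_scope.
Local Open Scope complex_scope.

(** For a quadratic potential the methods have exact invariants, and the theorem
    follows from them without any expansion into modified equations.

    Put u n = (x (n+1) - x n) / h and g n = Im (t (n+1) - t n) / h.  Each method
    is an implicit midpoint rule for (u, g), with magnetic field
    sigma B + rho E and electric field sigma E - rho B(x 0), where sigma - 1 and
    rho are real and O(h^2) ([methods_in_real_form], from [K1_O2] and its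
    companions).  Since B is frozen at x 0 in the second one, it is -grad U' for
    the quadratic potential U' = sigma U + rho B(x 0) . x.

    The field matrix is skew for the Lorentz form, so |u|^2 - g^2 is conserved
    ([mass_shell_invariant]).  The force is affine, so its work telescopes:
    g n + U'(x n, x (n+1)), with the polarized potential, is conserved too
    ([energy_invariant]).  Positions in a compact set thus bound g, and then u
    ([velocity_and_energy_bounds]), and recentring the energy invariant at the
    grid point shows that (g n + g (n-1)) / 2 + U'(x n) differs from its constant
    value by O(h^2) ([mid_factor_energy]).

    It remains to compare with gamma n + U(x n).  The momentum formulas give
    gamma n = (g n + g (n-1)) / 2 + O(h^2) ([momentum_perturbation]), and
    U' = U + O(h^2) on bounded sets ([potential_perturbation]).  Finally,
    exp (h F / 2) = 1 + h F / 2 + O(h^2) at the start shows that the constant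
    is gamma 0 + U(x 0) + O(h^2) ([starting_value_expansion],
    [initial_energy_perturbation]). *)

(** * Expansions of sine, cosine and their hyperbolic analogues *)

Section Asymptotics.
Context {R : realType}.
Implicit Types (l y a c h : R) (z : R[i]).

(** The mean value theorem from 0: the one tool behind the expansions below. *)
Lemma norm_le_of_derive (f df : R -> R) (M y : R) :
  f 0 = 0 -> (forall u : R, is_derive u 1 f (df u)) ->
  (forall u, 0 <= u <= y -> `|df u| <= M) -> 0 <= y -> `|f y| <= M * y.
Proof.
move=> f0 fd dfM y0.
have [|u uy] := @MVT_segment _ f df 0 y y0 (fun u _ => fd u).
  apply: continuous_subspaceT => u.
  by apply: differentiable_continuous; apply/derivable1_diffP; case: (fd u).
rewrite f0 !subr0 => ->; rewrite normrM (ger0_norm y0) ler_wpM2r // dfM //.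
Qed.

(** A pair with S' = D and D' = e S, where e is -1 for the circular and 1 for
    the hyperbolic functions, is expanded by three integrations from 0, which
    bound S, then D - 1, then S - y.  Both sign cases occur, because lambda1 is
    nonnegative and lambda2 nonpositive. *)
Lemma sine_cosine_pair_bounds (S D : R -> R) (e : R) :
  S 0 = 0 -> D 0 = 1 -> `|e| <= 1 ->
  (forall u : R, is_derive u 1 S (D u)) ->
  (forall u : R, is_derive u 1 D (e * S u)) ->
  (forall u, 0 <= u <= 1 -> `|D u| <= 3) ->
  forall y, 0 <= y <= 1 ->
    `|S y - y| <= 3 * y ^+ 3 /\ `|D y - 1| <= 3 * y ^+ 2.
Proof.
move=> S0 D0 e1 dS dD D3.
have Sy y : 0 <= y <= 1 -> `|S y| <= 3 * y.
  move=> /andP[y0 y1]; apply: (norm_le_of_derive S0 dS) => // u /andP[u0 uy].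
  by apply: D3; rewrite u0 (le_trans uy).
have Dy y : 0 <= y <= 1 -> `|D y - 1| <= 3 * y ^+ 2.
  move=> /andP[y0 y1]; rewrite expr2 mulrA.
  apply: (@norm_le_of_derive (fun u => D u - 1) (fun u => e * S u)) => //.
  - by rewrite D0 subrr.
  - move=> u; have dDu := dD u; apply: is_derive_eq; by rewrite subr0.
  - move=> u /andP[u0 uy]; rewrite normrM.
    apply: (le_trans (ler_piMl _ e1)) => //.
    apply: (le_trans (Sy u _)); first by rewrite u0 (le_trans uy).
    by rewrite ler_wpM2l.
move=> y /[dup] yI /andP[y0 y1]; split; last exact: Dy.
rewrite exprSr mulrA.
apply: (@norm_le_of_derive (fun u => S u - u) (fun u => D u - 1)) => //.
- by rewrite S0 subrr.
- move=> u /andP[u0 uy].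
  apply: (le_trans (Dy u _)); first by rewrite u0 (le_trans uy).
  by rewrite ler_wpM2l // lerXn2r // nnegrE.
Qed.

Definition sinhR y := (expR y - expR (- y)) / 2.
Definition coshR y := (expR y + expR (- y)) / 2.

Lemma hyperbolic_bounds y : 0 <= y <= 1 ->
  `|sinhR y - y| <= 3 * y ^+ 3 /\ `|coshR y - 1| <= 3 * y ^+ 2.
Proof.
apply: (@sine_cosine_pair_bounds sinhR coshR 1).
- by rewrite /sinhR oppr0 subrr mul0r.
- by rewrite /coshR oppr0 expR0; field.
- by rewrite normr1.
- move=> u; rewrite /sinhR /coshR; apply: is_derive_eq.
  by rewrite /GRing.scale /=; field.
- move=> u; rewrite /sinhR /coshR; apply: is_derive_eq.
  by rewrite /GRing.scale /=; field.
- move=> u /andP[u0 u1].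
  rewrite ger0_norm; last by rewrite divr_ge0 // addr_ge0 // expR_ge0.
  have : expR u <= expR 1 by rewrite ler_expR.
  have : expR (- u) <= expR 0 by rewrite ler_expR oppr_le0.
  (* 1 + x <= exp x at x = - 1 / 2 gives exp (1 / 2) <= 2, hence exp 1 <= 4. *)
  have e2 : 1 / 2 <= expR (- (1 / 2) : R).
    by have := @expR_ge1Dx R (- (1 / 2)); lra.
  have e4 : expR 1 <= 4 :> R.
    have -> : (1 : R) = 1 / 2 + 1 / 2 by field.
    have := expRxMexpNx_1 (1 / 2 : R); have := expR_gt0 (1 / 2 : R).
    rewrite expRD; nra.
  rewrite expR0 /coshR; lra.
Qed.

Lemma circular_bounds y : 0 <= y <= 1 ->
  `|sin y - y| <= 3 * y ^+ 3 /\ `|cos y - 1| <= 3 * y ^+ 2.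
Proof.
apply: (@sine_cosine_pair_bounds sin cos (- 1)).
- exact: sin0.
- exact: cos0.
- by rewrite normrN1.
- by move=> u; rewrite mulN1r; exact: is_derive_cos.
- move=> u _; rewrite ler_norml; have := cos_le1 u; have := cos_geN1 u; lra.
Qed.

End Asymptotics.

(** * The coefficients K1, ..., K4 are real and O(h^2)-close to their limits *)

Section Coefficients.
Context {R : realType}.
Implicit Types (l y a c h : R) (z : R -> R[i]).

(** The coefficients are defined through complex square roots and complex
    hyperbolic functions.  This predicate records at once that such an
    expression is in fact real and that it is O(h^2), so that reality and size
    are carried together through the formulas for K1, ..., K4. *)
Definition real_O2 z : Prop := exists c h0 : R, 0 < h0 /\
  forall h, 0 < h <= h0 -> exists2 a, `|a| <= c * h ^+ 2 & z h = a%:C.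

Lemma real_O2_eq z1 z2 :
  (forall h, 0 < h -> z1 h = z2 h) -> real_O2 z1 -> real_O2 z2.
Proof.
move=> eqz [c [h0 [h0_gt0 zc]]]; exists c, h0; split => // h hI.
have [a ac za] := zc h hI; exists a => //; rewrite -eqz //.
by case/andP: hI.
Qed.

Lemma real_O20 : real_O2 (fun=> 0).
Proof.
exists 0, 1; split => // h _; exists 0; last by [].
by rewrite normr0 mul0r.
Qed.

Lemma real_O2D z1 z2 : real_O2 z1 -> real_O2 z2 -> real_O2 (z1 \+ z2).
Proof.
move=> [c1 [h1 [h1_gt0 z1c]]] [c2 [h2 [h2_gt0 z2c]]].
exists (c1 + c2), (Num.min h1 h2); split; first by rewrite lt_min h1_gt0.
move=> h; rewrite le_min => /and3P[h0 hh1 hh2].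
have [|a1 a1c z1a] := z1c h; first by rewrite h0.
have [|a2 a2c z2a] := z2c h; first by rewrite h0.
exists (a1 + a2); last by rewrite /= z1a z2a rmorphD.
by rewrite mulrDl (le_trans (ler_normD _ _)) // lerD.
Qed.

Lemma real_O2Z a z : real_O2 z -> real_O2 (fun h => a%:C * z h).
Proof.
move=> [c [h0 [h0_gt0 zc]]]; exists (`|a| * c), h0; split => // h hI.
have [b bc zb] := zc h hI; exists (a * b); last by rewrite zb rmorphM.
by rewrite normrM -mulrA ler_wpM2l.
Qed.

Lemma real_O2_quadratic a : real_O2 (fun h => a%:C * h%:C ^+ 2).
Proof.
exists `|a|, 1; split => // h _; exists (a * h ^+ 2).
  by rewrite normrM (ger0_norm (sqr_ge0 h)).
by rewrite rmorphM rmorphXn.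
Qed.

Lemma expC_real y : expC y%:C = (expR y)%:C.
Proof. by rewrite /expC /= cos0 sin0 mulr1. Qed.

Lemma expC_imag y : expC ('i * y%:C) = cos y +i* sin y.
Proof.
rewrite /expC; simpc => /=.
by rewrite expR0 !mul1r.
Qed.

Lemma sqrtc_neg l : l < 0 -> sqrtc l%:C = 'i * (Num.sqrt (- l))%:C.
Proof.
move=> l0; rewrite /sqrtc /= eqxx expr0n addr0 sqrtr_sqr ltr0_norm //.
rewrite addNr mul0r sqrtr0 mul1r.
by have -> : (- l - l) / 2 = - l; [field | simpc].
Qed.

Lemma coshC_real y : coshC y%:C = (coshR y)%:C.
Proof.
by rewrite /coshC -rmorphN !expC_real -rmorphD /coshR fmorph_div rmorph_nat.
Qed.

Lemma sinhC_real y : sinhC y%:C = (sinhR y)%:C.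
Proof.
by rewrite /sinhC -rmorphN !expC_real -rmorphB /sinhR fmorph_div rmorph_nat.
Qed.

Lemma coshC_imag y : coshC ('i * y%:C) = (cos y)%:C.
Proof.
rewrite /coshC -mulrN -rmorphN !expC_imag cosN sinN.
have -> : (cos y +i* sin y) + (cos y -i* sin y) = 2 * (cos y)%:C.
  by rewrite mulr_natl mulr2n; apply/eqP; rewrite eq_complex /= subrr addr0 !eqxx.
by rewrite mulrC mulKf.
Qed.

Lemma sinhC_imag y : sinhC ('i * y%:C) = 'i * (sin y)%:C.
Proof.
rewrite /sinhC.
have -> : - ('i * y%:C) = 'i * (- y)%:C by rewrite rmorphN mulrN.
rewrite !expC_imag cosN sinN.
have -> : (cos y +i* sin y) - (cos y -i* sin y) = 2 * ('i * (sin y)%:C).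
  rewrite mulr_natl mulr2n; apply/eqP; rewrite eq_complex /= subrr opprK.
  by rewrite !mul0r !mul1r !(subr0, addr0, oppr0, add0r, eqxx).
by rewrite mulrC mulKf.
Qed.


Lemma quotient_bounds (s d y : R) : 0 < y <= 1 / 3 ->
  `|s - y| <= 3 * y ^+ 3 -> `|d - 1| <= 3 * y ^+ 2 ->
  `|s / d / y - 1| <= 9 * y ^+ 2 /\ `|d^-1 - 1| <= 9 * y ^+ 2.
Proof.
move=> /andP[y0 y3] sy d1.
have y2 : y ^+ 2 <= 1 / 9 by nra.
have d23 : 2 / 3 <= d by move: d1; rewrite ler_norml; lra.
have d0 : 0 < d by lra.
have -> : s / d / y - 1 = ((s - y) - y * (d - 1)) / (d * y).
  by field; rewrite !gt_eqF.
have -> : d^-1 - 1 = - (d - 1) / d by field; rewrite gt_eqF.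
have dy : 0 < d * y by rewrite mulr_gt0.
rewrite !normrM !normfV normrN (gtr0_norm d0) (gtr0_norm dy).
rewrite !ler_pdivrMr ?mulr_gt0 //; split.
- apply: (le_trans (ler_normB _ _)); rewrite normrM (gtr0_norm y0).
  have : y * `|d - 1| <= y * (3 * y ^+ 2) by rewrite ler_wpM2l // ltW.
  have : 0 <= y ^+ 3 by rewrite exprn_ge0 // ltW.
  by move: sy; rewrite !exprS expr0; nra.
- by apply: (le_trans d1); nra.
Qed.

Lemma tanh_div_sqrt_neq0 h l : l != 0 ->
  tanh_div_sqrt h l = tanhC ((h / 2)%:C * sqrtc l%:C) / sqrtc l%:C.
Proof. by rewrite /tanh_div_sqrt => /negbTE ->. Qed.

(** With y = k s, s = sqrt |l| and k = h / 2, the two functions of l are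
    S y / D y / s and 1 / D y for the pair (S, D) fitting the sign of l; the
    bound on h keeps y below 1 / 3, where the denominator D y is at least
    2 / 3. *)
Lemma tanh_sech_O2_of_pair (l : R) (S D : R -> R) (s : R) : 0 < s ->
  (forall y, 0 <= y <= 1 ->
    `|S y - y| <= 3 * y ^+ 3 /\ `|D y - 1| <= 3 * y ^+ 2) ->
  (forall h, tanh_div_sqrt h l = (S (h / 2 * s) / D (h / 2 * s) / s)%:C) ->
  (forall h, sech_sqrt h l = (D (h / 2 * s))^-1%:C) ->
  real_O2 (fun h => tanh_div_sqrt h l / (h / 2)%:C - 1) /\
  real_O2 (fun h => sech_sqrt h l - 1).
Proof.
move=> s0 SD TE sE.
have yI h : 0 < h <= 2 / (3 * s) -> 0 < h / 2 * s <= 1 / 3.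
  move=> /andP[h0 hs]; rewrite mulr_gt0 ?divr_gt0 //=.
  by move: hs; rewrite ler_pdivlMr ?mulr_gt0 //; lra.
have bounds h : 0 < h <= 2 / (3 * s) ->
    `|S (h / 2 * s) / D (h / 2 * s) / (h / 2 * s) - 1| <= 3 * s ^+ 2 * h ^+ 2 /\
    `|(D (h / 2 * s))^-1 - 1| <= 3 * s ^+ 2 * h ^+ 2.
  move=> hI; have yh := yI h hI; have /andP[y0 y3] := yh.
  have [|Sy Dy] := SD (h / 2 * s); first by rewrite ltW //; lra.
  have le9 : 9 * (h / 2 * s) ^+ 2 <= 3 * s ^+ 2 * h ^+ 2.
    have -> : 9 * (h / 2 * s) ^+ 2 = 9 / 4 * (h * s) ^+ 2 by field.
    have -> : 3 * s ^+ 2 * h ^+ 2 = 3 * (h * s) ^+ 2 by ring.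
    by have := sqr_ge0 (h * s); lra.
  have [b1 b2] := quotient_bounds yh Sy Dy.
  by split; apply: le_trans le9.
have h00 : 0 < 2 / (3 * s) by rewrite divr_gt0 ?mulr_gt0.
split; exists (3 * s ^+ 2), (2 / (3 * s)); split => // h hI;
  have [b1 b2] := bounds h hI.
- exists (S (h / 2 * s) / D (h / 2 * s) / (h / 2 * s) - 1) => //.
  by rewrite TE -fmorph_div rmorphB rmorph1 [in RHS]invfM mulrA (mulrAC _ s^-1).
- by exists ((D (h / 2 * s))^-1 - 1) => //; rewrite sE rmorphB rmorph1.
Qed.

Lemma tanh_sech_O2 l :
  real_O2 (fun h => tanh_div_sqrt h l / (h / 2)%:C - 1) /\
  real_O2 (fun h => sech_sqrt h l - 1).
Proof.
have [l0|l0|->] := ltgtP l 0; last first.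
- split.
  + apply: real_O2_eq real_O20 => h h0; rewrite /tanh_div_sqrt eqxx divff ?subrr //.
    by rewrite fmorph_eq0 mulf_neq0 ?invr_eq0 ?pnatr_eq0 // gt_eqF.
  + apply: real_O2_eq real_O20 => h h0.
    rewrite /sech_sqrt /sechC sqrtc0 mulr0 -(rmorph0 (real_complex R)).
    by rewrite coshC_real /coshR oppr0 expR0 divff // rmorph1 invr1 subrr.
- have s0 : 0 < Num.sqrt l by rewrite sqrtr_gt0.
  have sE : sqrtc l%:C = (Num.sqrt l)%:C by rewrite sqrtc_sqrtr // ler0c ltW.
  apply: (tanh_sech_O2_of_pair s0 (@hyperbolic_bounds R)) => h.
  + rewrite tanh_div_sqrt_neq0 ?gt_eqF // sE -rmorphM /tanhC.
    by rewrite sinhC_real coshC_real -!fmorph_div.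
  + by rewrite /sech_sqrt sE -rmorphM /sechC coshC_real fmorphV.
- have s0 : 0 < Num.sqrt (- l) by rewrite sqrtr_gt0 oppr_gt0.
  have sE := sqrtc_neg l0.
  apply: (tanh_sech_O2_of_pair s0 (@circular_bounds R)) => h.
  + rewrite tanh_div_sqrt_neq0 ?lt_eqF // sE mulrCA -rmorphM /tanhC.
    rewrite sinhC_imag coshC_imag !fmorph_div -(mulrA 'i) -mulf_div.
    by rewrite divff ?mul1r // eq_complex /= oner_eq0 andbF.
  + by rewrite /sech_sqrt sE mulrCA -rmorphM /sechC coshC_imag fmorphV.
Qed.

(** Reduces K1 to the same function of the eigenvalue as K2. *)
Lemma sqrt_tanhE h l : sqrt_tanh h l = l%:C * tanh_div_sqrt h l.
Proof.
rewrite /sqrt_tanh /tanh_div_sqrt; case: eqVneq => [->|l0].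
  by rewrite sqrtc0 !mul0r.
rewrite -[X in _ = X * _]sqr_sqrtc expr2 -mulrA [X in _ = _ * X]mulrC divfK //.
by rewrite sqrtc_eq0 fmorph_eq0.
Qed.

Implicit Types (E B : 'cV[R]_3).

Lemma step_neq0 h : 0 < h -> (h / 2)%:C != 0.
Proof. by move=> h0; rewrite fmorph_eq0 mulf_neq0 ?invr_eq0 ?pnatr_eq0 // gt_eqF. Qed.

(** K1 / k is the difference quotient of l * tanh_div_sqrt l / k between the two
    eigenvalues; replacing tanh_div_sqrt by its limit k leaves
    (lambda1 - lambda2) / d = 1. *)
Lemma K1_O2 E B : real_O2 (fun h => K1 h E B / (h / 2)%:C - 1).
Proof.
have [d0|d0] := eqVneq (dd E B) 0.
  apply: real_O2_eq real_O20 => h h0.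
  by rewrite /K1 d0 eqxx divff ?step_neq0 // subrr.
have [T1 _] := tanh_sech_O2 (lambda1 E B).
have [T2 _] := tanh_sech_O2 (lambda2 E B).
apply: real_O2_eq (real_O2D (real_O2Z (lambda1 E B / dd E B) T1)
                            (real_O2Z (- (lambda2 E B / dd E B)) T2)) => h h0.
rewrite /= /K1 (negbTE d0) !sqrt_tanhE.
have one : (1 : R[i]) = (lambda1 E B / dd E B)%:C - (lambda2 E B / dd E B)%:C.
  by rewrite -rmorphB -(rmorph1 (real_complex R)); congr _%:C;
    rewrite /lambda1 /lambda2; field.
rewrite [X in _ = _ - X]one !rmorphN !fmorph_div; ring.
Qed.

(** Only the difference of the two corrections survives, so K2 / k has no term
    of order 0. *)
Lemma K2_O2 E B : real_O2 (fun h => K2 h E B / (h / 2)%:C).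
Proof.
have [d0|d0] := eqVneq (dd E B) 0.
  apply: real_O2_eq real_O20 => h h0.
  by rewrite /K2 d0 eqxx mul0r.
have [T1 _] := tanh_sech_O2 (lambda1 E B).
have [T2 _] := tanh_sech_O2 (lambda2 E B).
apply: real_O2_eq (real_O2D (real_O2Z (r2 E B / dd E B) T1)
                            (real_O2Z (- (r2 E B / dd E B)) T2)) => h h0.
rewrite /= /K2 (negbTE d0) !rmorphN; ring.
Qed.

(** The weights (1 - r1 / d) / 2 and (1 + r1 / d) / 2 add up to 1. *)
Lemma K3_O2 E B : real_O2 (fun h => K3 h E B - 1).
Proof.
have [d0|d0] := eqVneq (dd E B) 0.
  apply: real_O2_eq real_O20 => h h0.
  by rewrite /K3 d0 eqxx subrr.
have [_ s1] := tanh_sech_O2 (lambda1 E B).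
have [_ s2] := tanh_sech_O2 (lambda2 E B).
apply: real_O2_eq (real_O2D (real_O2Z (2^-1 * (1 - r1 E B / dd E B)) s1)
                            (real_O2Z (2^-1 * (1 + r1 E B / dd E B)) s2)) => h h0.
rewrite /= /K3 (negbTE d0) !rmorphM rmorphB rmorphD rmorph1 fmorphV rmorph_nat.
by field; rewrite /= fmorph_eq0.
Qed.

Lemma K4_O2 E B : real_O2 (fun h => K4 h E B).
Proof.
have [d0|d0] := eqVneq (dd E B) 0.
  apply: real_O2_eq (real_O2_quadratic (- (1 / 8))) => h h0.
  rewrite /K4 d0 eqxx -rmorphXn -rmorphM -rmorphN; congr _%:C; by field.
have [_ s1] := tanh_sech_O2 (lambda1 E B).
have [_ s2] := tanh_sech_O2 (lambda2 E B).
apply: real_O2_eq (real_O2D (real_O2Z (dd E B)^-1 s1)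
                            (real_O2Z (- (dd E B)^-1) s2)) => h h0.
by rewrite /= /K4 (negbTE d0) rmorphN !fmorphV; ring.
Qed.

End Coefficients.

(** * First-order expansion of the matrix exponential *)

Section MatrixExponential.
Context {R : realType}.

(** The terms from the second one on carry a factor k ^ 2, and what remains is
    dominated by the series of expR c.  The convergence has to be established
    as well, since the limit of a divergent sequence is an arbitrary value. *)
Lemma exp_like_series_bound (u : nat -> R) (c k : R) : 0 <= c -> 0 <= k <= 1 ->
  (forall l, `|u l| <= k ^+ l * exp_coeff c l) ->
  `|limn (fun m => \sum_(l < m) u l) - (u 0%N + u 1%N)| <= expR c * k ^+ 2.
Proof.
move=> c0 /andP[k0 k1] uc.
have uE : (fun m => \sum_(l < m) u l) = series u by rewrite seriesEord.
have u_le l : `|u l| <= exp_coeff c l.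
  apply: le_trans (uc l) _.
  by rewrite ler_piMl ?exp_coeff_ge0 // exprn_ile1.
have cvgu : cvgn (series u).
  apply: normed_cvg; apply: series_le_cvg (is_cvg_series_exp_coeff c) => //= l.
  exact: exp_coeff_ge0.
have tail m : `|series u m.+2 - (u 0%N + u 1%N)| <= expR c * k ^+ 2.
  rewrite seriesEord /= !big_ord_recl /= addrA [X in `|X|]addrC addKr.
  apply: (@le_trans _ _ (\sum_(l < m) k ^+ 2 * exp_coeff c l.+2)).
    apply: (le_trans (ler_norm_sum _ _ _)); apply: ler_sum => l _.
    apply: (le_trans (uc _)); rewrite /bump /= !add1n.
    rewrite ler_wpM2r ?exp_coeff_ge0 // -(add2n l) exprD ler_piMr ?sqr_ge0 //.
    by rewrite exprn_ile1.
  rewrite -mulr_sumr mulrC ler_wpM2r ?sqr_ge0 //.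
  apply: (@le_trans _ _ (series (exp_coeff c) m.+2)).
    rewrite seriesEord /= !big_ord_recl /= addrA.
    by rewrite ler_wpDl // addr_ge0 ?exp_coeff_ge0.
  apply: nondecreasing_cvgn_le (is_cvg_series_exp_coeff c) _.
  apply/nondecreasing_seqP => n.
  by rewrite /series /= big_nat_recr //= lerDl exp_coeff_ge0.
have tailn m : (2 <= m)%N -> `|series u m - (u 0%N + u 1%N)| <= expR c * k ^+ 2.
  by case: m => [|[|m]] // _; exact: tail.
rewrite uE ler_distl; apply/andP; split.
- apply: limr_ge => //; exists 2%N => // m /= m2.
  by move: (tailn m m2); rewrite ler_distl => /andP[].
- apply: limr_le => //; exists 2%N => // m /= m2.
  by move: (tailn m m2); rewrite ler_distl => /andP[].
Qed.

Lemma normc_ge_Im (z : R[i]) : `|complex.Im z|%:C <= `|z|.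
Proof.
by case: z => a b; simpc; rewrite -sqrtr_sqr ler_wsqrtr // lerDr sqr_ge0.
Qed.

(** The sum c of all the moduli bounds every column sum, and an entry of
    M ^ l * M is at most c ^ l times a column sum of M. *)
Lemma mx_pow_entry_le n (M : 'M[R[i]]_n) :
  exists2 c : R, 0 <= c & forall l i j, `|(M ^+ l) i j| <= (c ^+ l)%:C.
Proof.
pose s : R[i] := \sum_j \sum_k `|M k j|.
have s0 : 0 <= s by rewrite sumr_ge0 // => j _; rewrite sumr_ge0.
have sE : (complex.Re s)%:C = s by rewrite RRe_real // ger0_real.
exists (complex.Re s); first by rewrite -ler0c sE.
elim=> [|l IH] i j.
  by rewrite expr0 mxE; case: (i == j); rewrite ?normr1 ?normr0 ?ler01.
rewrite exprSr mxE; apply: (le_trans (ler_norm_sum _ _ _)).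
apply: (@le_trans _ _ (\sum_k (complex.Re s ^+ l)%:C * `|M k j|)).
  by apply: ler_sum => k _; rewrite normrM ler_wpM2r.
rewrite -mulr_sumr exprSr rmorphM /= sE ler_wpM2l //.
  by rewrite ler0c exprn_ge0 // -ler0c sE.
rewrite /s [leRHS](bigD1 j) //= lerDl sumr_ge0 // => j' _; exact: sumr_ge0.
Qed.

Lemma ReD (z1 z2 : R[i]) : complex.Re (z1 + z2) = complex.Re z1 + complex.Re z2.
Proof. by case: z1; case: z2. Qed.

Lemma ImD (z1 z2 : R[i]) : complex.Im (z1 + z2) = complex.Im z1 + complex.Im z2.
Proof. by case: z1; case: z2. Qed.

Lemma ReM_real (a : R) (z : R[i]) : complex.Re (a%:C * z) = a * complex.Re z.
Proof. by case: z => x y /=; rewrite mul0r subr0. Qed.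

Lemma ImM_real (a : R) (z : R[i]) : complex.Im (a%:C * z) = a * complex.Im z.
Proof. by case: z => x y /=; rewrite mul0r addr0. Qed.

Lemma scalemx_pow n (a : R[i]) (M : 'M[R[i]]_n) l :
  (a *: M) ^+ l = a ^+ l *: M ^+ l.
Proof.
elim: l => [|l IH]; first by rewrite !expr0 scale1r.
rewrite !exprS IH -[LHS]/(_ *m _) -[M * _]/(_ *m _).
by rewrite -scalemxAl -scalemxAr scalerA.
Qed.

(** exp (k M) = 1 + k M + O(k^2).  Both components of an entry are instances of
    the same scalar series. *)
Lemma expmx_linearization n (M : 'M[R[i]]_n) : exists c : R,
  forall k : R, 0 <= k <= 1 -> forall i j,
    `|complex.Re ((expmx (k%:C *: M) - (1 + k%:C *: M)) i j)| <= c * k ^+ 2 /\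
    `|complex.Im ((expmx (k%:C *: M) - (1 + k%:C *: M)) i j)| <= c * k ^+ 2.
Proof.
have [c c0 Mc] := mx_pow_entry_le M.
exists (expR c) => k kI i j.
pose term l := (l`!%:R)^-1 *: (k%:C *: M) ^+ l.
have termE l : term l i j = (k ^+ l / l`!%:R)%:C * (M ^+ l) i j.
  rewrite /term scalemx_pow mxE mxE mulrA fmorph_div rmorphXn rmorph_nat.
  by congr (_ * _); rewrite mulrC.
have bound (f : R[i] -> R) : (forall z, `|f z|%:C <= `|z|) ->
    (forall a z, f (a%:C * z) = a * f z) ->
    forall l, `|f (term l i j)| <= k ^+ l * exp_coeff c l.
  move=> f_le fM l; rewrite termE fM /exp_coeff /= normrM normrM.
  have k0 : 0 <= k ^+ l by rewrite exprn_ge0 //; case/andP: kI.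
  have l0 : 0 <= (l`!%:R : R)^-1 by rewrite invr_ge0.
  rewrite (ger0_norm k0) (ger0_norm l0) -mulrA ler_wpM2l // mulrC ler_wpM2r //.
  by rewrite -lecR; exact: le_trans (f_le _) (Mc _ _ _).
have sumE : forall f : R[i] -> R, (forall z1 z2, f (z1 + z2) = f z1 + f z2) ->
    f 0 = 0 -> forall m, f ((\sum_(l < m) term l) i j) = \sum_(l < m) f (term l i j).
  move=> f fD f0 m; rewrite summxE; apply: (big_morph f fD f0).
have t0 : term 0%N = 1 by rewrite /term expr0 fact0 invr1 scale1r.
have t1 : term 1%N = k%:C *: M by rewrite /term expr1 invr1 scale1r.
have split_at : forall f : R[i] -> R, (forall z1 z2, f (z1 + z2) = f z1 + f z2) ->
    (forall z, f (- z) = - f z) ->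
    f ((expmx (k%:C *: M) - (1 + k%:C *: M)) i j) =
    f (expmx (k%:C *: M) i j) - (f (term 0%N i j) + f (term 1%N i j)).
  by move=> f fD fN; rewrite t0 t1 mxE fD; congr (_ + _); rewrite mxE fN mxE fD.
split.
- rewrite split_at; [|exact: ReD|by case].
  rewrite mxE /= (_ : (fun m => _) = (fun m => \sum_(l < m) complex.Re (term l i j))).
    by apply: (exp_like_series_bound (u := fun l => complex.Re (term l i j))) => //; apply: bound;
      [exact: normc_ge_Re | exact: ReM_real].
  by apply/funext => m; rewrite (sumE _ ReD).
- rewrite split_at; [|exact: ImD|by case].
  rewrite mxE /= (_ : (fun m => complex.Im _) = (fun m => \sum_(l < m) complex.Im (term l i j))).
    by apply: (exp_like_series_bound (u := fun l => complex.Im (term l i j))) => //; apply: bound;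
      [exact: normc_ge_Im | exact: ImM_real].
  by apply/funext => m; rewrite (sumE _ ImD).
Qed.

End MatrixExponential.

(** * Scalar and vector products in dimension three *)

Section VectorAlgebra.
Context {R : realType}.
Implicit Types (a b c : 'cV[R]_3) (k : R).

Lemma dotE a b :
  dot a b = a i0 0 * b i0 0 + a i1 0 * b i1 0 + a i2 0 * b i2 0.
Proof.
have E0 : ord0 = i0 by apply/val_inj.
have E1 : lift i0 ord0 = i1 by apply/val_inj.
have E2 : lift i0 (lift ord0 ord0) = i2 by apply/val_inj.
by rewrite /dot mxE !big_ord_recl big_ord0 E0 E1 E2 !mxE addr0 addrA.
Qed.

Lemma dotC a b : dot a b = dot b a.
Proof. by rewrite !dotE; ring. Qed.

Lemma dotDl a b c : dot (a + b) c = dot a c + dot b c.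
Proof. by rewrite !dotE !mxE; ring. Qed.

Lemma dotZl k a b : dot (k *: a) b = k * dot a b.
Proof. by rewrite !dotE !mxE; ring. Qed.

Lemma dotNl a b : dot (- a) b = - dot a b.
Proof. by rewrite !dotE !mxE; ring. Qed.

Lemma dotDr a b c : dot a (b + c) = dot a b + dot a c.
Proof. by rewrite dotC dotDl !(dotC _ a). Qed.

Lemma dotZr k a b : dot a (k *: b) = k * dot a b.
Proof. by rewrite dotC dotZl dotC. Qed.

Lemma dotNr a b : dot a (- b) = - dot a b.
Proof. by rewrite dotC dotNl dotC. Qed.

Definition dot_linear := (dotDl, dotDr, dotZl, dotZr, dotNl, dotNr).

Lemma cross_orthogonal a b : dot (cross a b) a = 0.
Proof. by rewrite dotE !mxE /=; ring. Qed.

Lemma crossDr a b c : cross a (b + c) = cross a b + cross a c.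
Proof.
apply/colP => i; rewrite !mxE.
by case: i => -[|[|[|//]]] /= ?; ring.
Qed.

Lemma crossZr k a b : cross a (k *: b) = k *: cross a b.
Proof.
apply/colP => i; rewrite !mxE.
by case: i => -[|[|[|//]]] /= ?; ring.
Qed.

Lemma dot_symmetric (Q : 'M[R]_3) a b : Q^T = Q -> dot a (Q *m b) = dot b (Q *m a).
Proof.
move=> QT; rewrite [RHS]dotC /dot trmx_mul QT.
by rewrite mulmxA.
Qed.

Lemma entry_le_norm m n (M : 'M[R]_(m, n)) i j : `|M i j| <= `|M|.
Proof.
rewrite [leRHS]/Num.norm /= mx_normrE.
exact: (le_bigmax _ (fun ij : 'I_m * 'I_n => `|M ij.1 ij.2|) (i, j)).
Qed.

Lemma norm_le_entries m n (M : 'M[R]_(m, n)) k : 0 <= k ->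
  (forall i j, `|M i j| <= k) -> `|M| <= k.
Proof.
move=> k0 Mk; rewrite [leLHS]/Num.norm /= mx_normrE.
by apply/bigmax_leP; split => // -[i j] _; exact: Mk.
Qed.

(** For the maximum norm, the constant of the Cauchy-Schwarz inequality becomes
    the dimension. *)
Lemma norm_dot_le a b : `|dot a b| <= 3 * `|a| * `|b|.
Proof.
have ab i : `|a i 0 * b i 0| <= `|a| * `|b|.
  by rewrite normrM ler_pM // entry_le_norm.
rewrite dotE; have := ab i0; have := ab i1; have := ab i2.
set p0 := a i0 0 * _; set p1 := a i1 0 * _; set p2 := a i2 0 * _.
rewrite !ler_norml; lra.
Qed.

Lemma norm_cross_le a b : `|cross a b| <= 2 * `|a| * `|b|.
Proof.
have ab i j : `|a i 0 * b j 0| <= `|a| * `|b|.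
  by rewrite normrM ler_pM // entry_le_norm.
have abB i j i' j' : `|a i 0 * b j 0 - a i' 0 * b j' 0| <= 2 * `|a| * `|b|.
  by apply: (le_trans (ler_normB _ _)); have := ab i j; have := ab i' j'; lra.
apply: norm_le_entries; first by rewrite !mulr_ge0.
by move=> i j; rewrite mxE; case: i => -[|[|[|//]]] /= ?; exact: abB.
Qed.

(** The norm is the maximum norm, while the conserved quantity is Euclidean:
    this is the comparison by which the latter controls the former. *)
Lemma norm_sqr_le_dot a : `|a| ^+ 2 <= dot a a.
Proof.
have aa i : a i 0 ^+ 2 <= dot a a.
  have := sqr_ge0 (a i0 0); have := sqr_ge0 (a i1 0); have := sqr_ge0 (a i2 0).
  rewrite dotE -!expr2.
  have : i \in [:: i0; i1; i2] by case: i => -[|[|[|//]]].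
  by rewrite !inE => /or3P[] /eqP ->; lra.
have d0 : 0 <= dot a a by apply: le_trans (aa i0); exact: sqr_ge0.
rewrite -ler_sqrt ?sqr_ge0 // sqrtr_sqr normr_id.
apply: norm_le_entries; first exact: sqrtr_ge0.
by move=> i j; rewrite (ord1 j) -sqrtr_sqr ler_sqrt.
Qed.

Lemma norm_mulmx_le (M : 'M[R]_3) a : `|M *m a| <= 3 * `|M| * `|a|.
Proof.
apply: norm_le_entries; first by rewrite !mulr_ge0.
move=> i j; rewrite mxE; apply: (le_trans (ler_norm_sum _ _ _)).
apply: (@le_trans _ _ (\sum_(k < 3) `|M| * `|a|)).
  by apply: ler_sum => k _; rewrite normrM ler_pM // entry_le_norm.
by rewrite sumr_const card_ord -mulrA mulr_natl.
Qed.

Lemma quadratic_potentialE (Q : 'M[R]_3) q a :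
  quadratic_potential Q q a = 2^-1 * dot a (Q *m a) + dot q a.
Proof. by rewrite /quadratic_potential /dot mulmxA. Qed.

End VectorAlgebra.

(** * Exact invariants of the implicit midpoint scheme *)

Section RealScheme.
Context {R : realType}.
Implicit Types (h c k : R) (Q : 'M[R]_3) (q a : 'cV[R]_3).
Implicit Types (X u b : nat -> 'cV[R]_3) (g : nat -> R) (n : nat).

Definition mid_velocity u n : 'cV[R]_3 := 2^-1 *: (u n.-1 + u n).
Definition mid_factor g n : R := 2^-1 * (g n.-1 + g n).
Definition force Q q a : 'cV[R]_3 := - (Q *m a + q).

(** The two-step method in terms of the half-step quantities
    u n = (X (n+1) - X n) / h and g n = (t (n+1) - t n) / (i h), which live at
    n + 1 / 2: one step is an implicit midpoint rule for a velocity and a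
    relativistic factor moving in the fields b and -grad U, evaluated at X n. *)
Definition implicit_midpoint h Q q b X u g n : Prop :=
  u n = u n.-1 + h *: (cross (mid_velocity u n) (b n)
                       + mid_factor g n *: force Q q (X n)) /\
  g n = g n.-1 + h * dot (force Q q (X n)) (mid_velocity u n).

(** The symmetric polarization of the quadratic potential: it is the
    potential energy seen by the half-step quantities. *)
Definition polarized_potential Q q (a1 a2 : 'cV[R]_3) : R :=
  2^-1 * (dot a1 (Q *m a2) + dot q (a1 + a2)).

(** Exact, without a second-order remainder in the displacement, since one of
    the two factors of the quadratic term is kept at the base point. *)
Lemma polarized_potential_step Q q a1 a2 : Q^T = Q ->
  polarized_potential Q q a1 (a1 + a2) =
  quadratic_potential Q q a1 - 2^-1 * dot (force Q q a1) a2.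
Proof.
move=> QT; rewrite quadratic_potentialE /polarized_potential /force.
rewrite mulmxDr !dot_linear (dot_symmetric a1 a2 QT).
by rewrite (dotC a2); field.
Qed.

Lemma polarized_potentialC Q q a1 a2 : Q^T = Q ->
  polarized_potential Q q a1 a2 = polarized_potential Q q a2 a1.
Proof.
by move=> QT; rewrite /polarized_potential (dot_symmetric _ _ QT) [a1 + _]addrC.
Qed.

Section Trajectory.
Context (h : R) (Q : 'M[R]_3) (q : 'cV[R]_3).
Context (b X u : nat -> 'cV[R]_3) (g : nat -> R) (n : nat).
Context (QT : Q^T = Q) (Xu : forall j, X j.+1 = X j + h *: u j).
Context (step : forall j, (j < n)%N -> implicit_midpoint h Q q b X u g j.+1).

(** The magnetic term is orthogonal to the mid-velocity, and the electric terms
    change dot u u and g ^ 2 by the same amount: the field matrix acts as an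
    infinitesimal Lorentz transformation and the midpoint rule preserves its
    quadratic form. *)
Lemma mass_shell_invariant j : (j <= n)%N ->
  dot (u j) (u j) - g j ^+ 2 = dot (u 0%N) (u 0%N) - g 0%N ^+ 2.
Proof.
elim: j => // j IH jn; rewrite -IH ?(ltnW jn) //.
have [uE gE] := step jn; rewrite /= in uE gE.
pose s := mid_velocity u j.+1; pose r := mid_factor g j.+1.
have uu : dot (u j.+1) (u j.+1) - dot (u j) (u j) = 2 * dot (u j.+1 - u j) s.
  by rewrite /s /mid_velocity /= !dot_linear (dotC (u j.+1) (u j)); field.
have gg : g j.+1 ^+ 2 - g j ^+ 2 = 2 * (g j.+1 - g j) * r.
  by rewrite /r /mid_factor /=; field.
suff : dot (u j.+1 - u j) s = (g j.+1 - g j) * r by lra.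
rewrite {1}uE {1}gE -/s -/r [X in dot X _]addrAC subrr add0r.
by rewrite dotZl dotDl dotZl cross_orthogonal; ring.
Qed.

(** The work h * dot (force (X j)) (mid_velocity u j) equals
    dot (force (X j)) (X (j+1) - X (j-1)) / 2, which for a linear force
    telescopes.  This is where the potential has to be quadratic. *)
Lemma energy_invariant j : (j <= n)%N ->
  g j + polarized_potential Q q (X j) (X j.+1) =
  g 0%N + polarized_potential Q q (X 0%N) (X 1%N).
Proof.
elim: j => // j IH jn; rewrite -IH ?(ltnW jn) //.
have [_ gE] := step jn; rewrite /= in gE.
rewrite (polarized_potentialC q (X j) _ QT).
have -> : X j = X j.+1 + - (h *: u j) by rewrite Xu addrK.
rewrite [X j.+2]Xu !polarized_potential_step // gE /mid_velocity /= !dot_linear.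
by field.
Qed.

(** The conserved half-step energy, recentred at the grid point: the first-order
    terms from the two neighbouring half steps cancel by symmetry, which leaves
    a remainder of size h ^ 2. *)
Lemma mid_factor_energy : (0 < n)%N ->
  mid_factor g n + quadratic_potential Q q (X n) =
  g 0%N + polarized_potential Q q (X 0%N) (X 1%N) +
  h ^+ 2 / 4 * dot (force Q q (X n))
     (cross (mid_velocity u n) (b n) + mid_factor g n *: force Q q (X n)).
Proof.
case: n step energy_invariant => // m stepm inv _.
have [uE gE] := stepm m (ltnSn m); rewrite -(inv m (leqnSn m)) /= in uE gE *.
rewrite (polarized_potentialC q (X m) _ QT).
have -> : X m = X m.+1 + - (h *: u m) by rewrite Xu addrK.
rewrite polarized_potential_step //.
set w := cross _ _ + _ in uE *.
have vE : mid_velocity u m.+1 = u m + (h / 2) *: w.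
  rewrite /mid_velocity /= uE; by apply/colP => i; rewrite !mxE; field.
have -> : mid_factor g m.+1 = g m + h / 2 * dot (force Q q (X m.+1)) (mid_velocity u m.+1).
  by rewrite {1}/mid_factor /= gE; field.
by rewrite vE !dot_linear; field.
Qed.

Lemma norm_force_le c a : 1 <= c -> `|Q| <= c -> `|q| <= c -> `|a| <= c ->
  `|force Q q a| <= 4 * c ^+ 2.
Proof.
move=> c1 Qc qc ac; rewrite /force normrN; apply: (le_trans (ler_normD _ _)).
have c2 : c <= c ^+ 2 by rewrite expr2 ler_peMl // (le_trans ler01).
have := norm_mulmx_le Q a.
have : `|Q| * `|a| <= c ^+ 2 by rewrite expr2 ler_pM.
lra.
Qed.

Lemma norm_polarized_potential_le c a1 a2 :
  1 <= c -> `|Q| <= c -> `|q| <= c -> `|a1| <= c -> `|a2| <= c ->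
  `|polarized_potential Q q a1 a2| <= 8 * c ^+ 3.
Proof.
move=> c1 Qc qc a1c a2c; rewrite /polarized_potential normrM [`|2^-1|]ger0_norm //.
have c2 : c <= c ^+ 2 by rewrite expr2 ler_peMl // (le_trans ler01).
have c3 : c ^+ 2 <= c ^+ 3 by rewrite exprS ler_peMl // sqr_ge0.
have d1 : `|dot a1 (Q *m a2)| <= 9 * c ^+ 3.
  apply: (le_trans (norm_dot_le _ _)).
  have -> : 9 * c ^+ 3 = 3 * c * (3 * c * c) by ring.
  apply: ler_pM; rewrite ?mulr_ge0 // ?ler_wpM2l //.
  by apply: (le_trans (norm_mulmx_le _ _)); rewrite ler_pM ?mulr_ge0 // ler_wpM2l.
have d2 : `|dot q (a1 + a2)| <= 6 * c ^+ 2.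
  apply: (le_trans (norm_dot_le _ _)).
  have -> : 6 * c ^+ 2 = 3 * c * (c + c) by ring.
  apply: ler_pM; rewrite ?mulr_ge0 // ?ler_wpM2l //.
  by apply: (le_trans (ler_normD _ _)); rewrite lerD.
have := ler_normD (dot a1 (Q *m a2)) (dot q (a1 + a2)).
by lra.
Qed.

(** Boundedness of positions is enough to bound velocities: energy conservation
    bounds g by the potential, the mass shell then bounds u.  Only the positions
    up to X n are assumed bounded, so the last mid-velocity is obtained from the
    half step n - 1 by solving the implicit relation, a contraction as soon as
    h * (14 * c ^ 2) <= 1.  The numerical constants come from
    |force| <= 4 c^2, |polarized potential| <= 8 c^3, |g| <= 17 c^3 and
    |u| <= 20 c^3. *)
Lemma velocity_and_energy_bounds c : 1 <= c -> (0 < n)%N ->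
  0 < h -> h * (14 * c ^+ 2) <= 1 ->
  `|Q| <= c -> `|q| <= c -> `|b n| <= c -> `|u 0%N| <= c -> `|g 0%N| <= c ->
  (forall j, (j <= n)%N -> `|X j| <= c) ->
  [/\ `|mid_velocity u n| <= 74 * c ^+ 3,
      `|mid_factor g n| <= 74 * c ^+ 3 &
      `|mid_factor g n + quadratic_potential Q q (X n) -
        (g 0%N + polarized_potential Q q (X 0%N) (X 1%N))|
        <= 1332 * c ^+ 7 * h ^+ 2].
Proof.
move=> c1 n0 h0 hc Qc qc bc u0c g0c Xc.
have c0 : 0 <= c by apply: le_trans c1.
have c2 : c <= c ^+ 2 by rewrite expr2 ler_peMl.
have c3 : c ^+ 2 <= c ^+ 3 by rewrite exprS ler_peMl // sqr_ge0.
have n1 : (n.-1 < n)%N by rewrite prednK.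
have [uE gE] := step n1; rewrite prednK // in uE gE.
have fc : `|force Q q (X n)| <= 4 * c ^+ 2 by apply: norm_force_le => //; apply: Xc.
have U0 : `|polarized_potential Q q (X 0%N) (X 1%N)| <= 8 * c ^+ 3.
  by apply: norm_polarized_potential_le => //; apply: Xc.
have Un : `|polarized_potential Q q (X n.-1) (X n)| <= 8 * c ^+ 3.
  by apply: norm_polarized_potential_le => //; apply: Xc => //; exact: ltnW.
have gc : `|g n.-1| <= 17 * c ^+ 3.
  have := energy_invariant (ltnW n1); rewrite prednK //.
  by move: U0 Un g0c; rewrite !ler_norml; lra.
have uc : `|u n.-1| <= 20 * c ^+ 3.
  have := mass_shell_invariant (ltnW n1).
  have := norm_sqr_le_dot (u n.-1); have := norm_dot_le (u 0%N) (u 0%N).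
  have : `|u 0%N| * `|u 0%N| <= c ^+ 3 * c ^+ 3 by rewrite ler_pM // ?(le_trans u0c) ?(le_trans c2).
  have : g n.-1 ^+ 2 <= (17 * c ^+ 3) ^+ 2.
    by rewrite -real_normK ?num_real // lerXn2r // ?nnegrE // (le_trans (normr_ge0 _) gc).
  have := sqr_ge0 (g 0%N).
  have := ler_norm (dot (u 0%N) (u 0%N)); have := sqr_ge0 (c ^+ 3) => *.
  suff : `|u n.-1| ^+ 2 <= (20 * c ^+ 3) ^+ 2.
    by rewrite ler_pXn2r // ?nnegrE ?mulr_ge0 ?exprn_ge0.
  lra.
set V := `|mid_velocity u n|; set G := `|mid_factor g n|.
pose w := cross (mid_velocity u n) (b n) + mid_factor g n *: force Q q (X n).
have V0 : 0 <= V := normr_ge0 _.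
have G0 : 0 <= G := normr_ge0 _.
have wc : `|w| <= 2 * c ^+ 2 * V + 4 * c ^+ 2 * G.
  apply: (le_trans (ler_normD _ _)); apply: lerD.
    apply: (le_trans (norm_cross_le _ _)); rewrite -/V.
    have : V * `|b n| <= V * c ^+ 2 by rewrite ler_wpM2l // (le_trans bc).
    lra.
  by rewrite normrZ -/G mulrC ler_wpM2r.
have VE : V <= 20 * c ^+ 3 + h / 2 * `|w|.
  have -> : V = `|u n.-1 + (h / 2) *: w|.
    by rewrite /V /mid_velocity {1}uE -/w; congr `|_|; apply/colP => i; rewrite !mxE; field.
  apply: (le_trans (ler_normD _ _)); rewrite lerD // normrZ ger0_norm //.
  by rewrite divr_ge0 // ltW.
have GE : G <= 17 * c ^+ 3 + h / 2 * (3 * (4 * c ^+ 2) * V).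
  have -> : G = `|g n.-1 + h / 2 * dot (force Q q (X n)) (mid_velocity u n)|.
    by rewrite /G {1}/mid_factor gE; congr `|_|; field.
  apply: (le_trans (ler_normD _ _)); rewrite lerD // normrM ger0_norm; last first.
    by rewrite divr_ge0 // ltW.
  rewrite ler_wpM2l ?divr_ge0 ?(ltW h0) //.
  by apply: (le_trans (norm_dot_le _ _)); rewrite ler_wpM2r // ler_wpM2l.
(* V + G <= 37 c^3 + (V + G) / 2. *)
have VG : V + G <= 74 * c ^+ 3.
  have hw : h / 2 * `|w| <= h / 2 * (2 * c ^+ 2 * V + 4 * c ^+ 2 * G).
    by rewrite ler_wpM2l // divr_ge0 // ltW.
  have hV : h * (14 * c ^+ 2) * V <= 1 * V by rewrite ler_wpM2r.
  have hG : h * (14 * c ^+ 2) * G <= 1 * G by rewrite ler_wpM2r.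
  lra.
split; [lra | lra |].
rewrite mid_factor_energy // -/w addrAC subrr add0r normrM ger0_norm; last first.
  by rewrite divr_ge0 // sqr_ge0.
have wc2 : `|w| <= 6 * c ^+ 2 * (74 * c ^+ 3).
  have : c ^+ 2 * V <= c ^+ 2 * (74 * c ^+ 3) by rewrite ler_wpM2l ?sqr_ge0 //; lra.
  have : c ^+ 2 * G <= c ^+ 2 * (74 * c ^+ 3) by rewrite ler_wpM2l ?sqr_ge0 //; lra.
  lra.
have : `|dot (force Q q (X n)) w| <= 3 * (4 * c ^+ 2) * (6 * c ^+ 2 * (74 * c ^+ 3)).
  apply: (le_trans (norm_dot_le _ _)); apply: ler_pM; rewrite ?mulr_ge0 //.
  by rewrite ler_wpM2l.
move=> dw; apply: (le_trans (ler_wpM2l _ dw)); first by rewrite divr_ge0 // sqr_ge0.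
by rewrite le_eqVlt; apply/orP; left; apply/eqP; field.
Qed.

End Trajectory.

End RealScheme.

(** * The three methods in real form *)

Section RealForm.
Context {R : realType}.
Implicit Types (E B : 'cV[R]_3 -> 'cV[R]_3) (x v : nat -> 'cV[R]_3).
Implicit Types (t w : nat -> R[i]) (h : R).

Lemma toCD m n (M1 M2 : 'M[R]_(m, n)) : toC (M1 + M2) = toC M1 + toC M2.
Proof. exact: map_mxD. Qed.

Lemma toCB m n (M1 M2 : 'M[R]_(m, n)) : toC (M1 - M2) = toC M1 - toC M2.
Proof. exact: map_mxB. Qed.

Lemma toCZ m n (a : R) (M : 'M[R]_(m, n)) : toC (a *: M) = a%:C *: toC M.
Proof. exact: map_mxZ. Qed.

Lemma toCM m n p (M1 : 'M[R]_(m, n)) (M2 : 'M[R]_(n, p)) :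
  toC (M1 *m M2) = toC M1 *m toC M2.
Proof. exact: map_mxM. Qed.

Lemma toCT m n (M : 'M[R]_(m, n)) : toC M^T = (toC M)^T.
Proof. by rewrite /toC map_trmx. Qed.

Lemma toC_dot (a b : 'cV[R]_3) : ((toC a)^T *m toC b) 0 0 = (dot a b)%:C.
Proof. by rewrite -toCT -toCM /toC mxE. Qed.

Lemma real_part_of_combination (a b c : 'cV[R]_3) (z : R[i]) :
  toC a = toC b - z *: toC c -> a = b - complex.Re z *: c.
Proof.
case: z => z1 z2 /colP abc; apply/colP => i.
have := congr1 (@complex.Re R) (abc i); rewrite !mxE /=.
by rewrite mulr0 subr0.
Qed.

Definition half_velocity h x n : 'cV[R]_3 := h^-1 *: (x n.+1 - x n).
Definition half_factor h t n : R := h^-1 * complex.Im (t n.+1 - t n).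

Lemma diff1_position h x n : (0 < n)%N ->
  diff1 h (fun j => toC (x j)) n = toC (mid_velocity (half_velocity h x) n).
Proof.
case: n => // n _; rewrite /diff1 -toCB -fmorphV -toCZ; congr toC.
rewrite /mid_velocity /half_velocity -scalerDr scalerA invfM /=.
by congr (_ *: _); apply/colP => i; rewrite !mxE; ring.
Qed.

Lemma diff2_position h x n : (0 < n)%N ->
  diff2 h (fun j => toC (x j)) n =
  toC (h^-1 *: (half_velocity h x n - half_velocity h x n.-1)).
Proof.
case: n => // n _; rewrite /diff2 -(rmorph_nat (real_complex R) 2) /= -toCZ.
rewrite -toCB -toCD -fmorphV -toCZ; congr toC.
rewrite /half_velocity -scalerBr scalerA expr2 invfM.
by congr (_ *: _); apply/colP => i; rewrite !mxE; ring.
Qed.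

Lemma diff1_time h t n : (0 < n)%N ->
  complex.Im (diff1 h (t : nat -> R[i]^o) n : R[i]) = mid_factor (half_factor h t) n.
Proof.
case: n => // n _; rewrite /diff1 /mid_factor /half_factor /= -fmorphV.
rewrite [_ *: _]/(_ * _) ImM_real invfM.
by case: (t n.+2) (t n.+1) (t n) => [a2 b2] [a1 b1] [a0 b0] /=; ring.
Qed.

Lemma diff2_time h t n : (0 < n)%N ->
  complex.Im (diff2 h (t : nat -> R[i]^o) n : R[i]) =
  h^-1 * (half_factor h t n - half_factor h t n.-1).
Proof.
case: n => // n _; rewrite /diff2 /half_factor /= -fmorphV.
rewrite [_ *: (_ + _)]/(_ * _) ImM_real expr2 invfM.
rewrite scaler_nat mulr2n.
by case: (t n.+2) (t n.+1) (t n) => [a2 b2] [a1 b1] [a0 b0] /=; ring.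
Qed.

Lemma tilde_linear (k1 k2 : R) (b1 b2 : 'cV[R]_3) :
  tilde (k1 *: b1 + k2 *: b2) = k1 *: tilde b1 + k2 *: tilde b2.
Proof. by apply/matrixP => i j; rewrite [LHS]mxE crossDr !crossZr !mxE. Qed.

(** All three methods have this form: the magnetic field becomes
    sigma B + rho E and the electric field sigma E - rho B(x 0).  The latter
    is again minus the gradient of a quadratic potential, because B is frozen at
    x 0 there. *)
Definition real_recursion E B h x t (sigma rho : R) n : Prop :=
  let u := half_velocity h x in let g := half_factor h t in
  let e := sigma *: E (x n) - rho *: B (x 0%N) in
  u n = u n.-1 + h *: (cross (mid_velocity u n) (sigma *: B (x n) + rho *: E (x n))
                       + mid_factor g n *: e) /\
  g n = g n.-1 + h * dot e (mid_velocity u n).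

Definition real_momentum E B h x t w (s3 s4 : R) n : Prop :=
  let u := half_velocity h x in let g := half_factor h t in
  complex.Im (w n) = s4 * dot (E (x n)) (cross (mid_velocity u n) (B (x n)))
    + (s3 + s4 * dot (E (x n)) (E (x n))) * mid_factor g n.

(** The time variable is imaginary, so multiplication by the imaginary unit
    brings it back to the real side. *)
Lemma Re_Im_mul_imaginary h (z : R[i]) :
  complex.Re (2 * 'i / h%:C * z) = - (2 / h * complex.Im z) /\
  complex.Im (2 * 'i / h%:C * z) = 2 / h * complex.Re z.
Proof.
have two : 2 / h%:C = (2 / h)%:C :> R[i] by rewrite fmorph_div rmorph_nat.
rewrite (mulrAC 2) two -(mulrA _%:C).
rewrite ReM_real ImM_real; case: z => a b /=.
by rewrite !mul0r !mul1r sub0r add0r mulrN.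
Qed.

(** The positions are real and the time variable is imaginary, so the dynamics
    is read off the real part of the position equation and the imaginary part
    of the time equation. *)
Lemma real_recursion_of E B h x t (sigma rho : R) n (z1 z2 : R[i]) :
  (0 < n)%N -> 0 < h ->
  z1 = (h / 2 * sigma)%:C -> z2 = (h / 2 * rho)%:C ->
  diff2 h (fun j => toC (x j)) n =
    (2 / h%:C) *: ((z1 *: toC (tilde (B (x n))) + z2 *: toC (tilde (E (x n))))
                    *m diff1 h (fun j => toC (x j)) n)
    - (2 * 'i / h%:C * (diff1 h (t : nat -> R[i]^o) n : R[i]))
       *: (z1 *: toC (E (x n)) - z2 *: toC (B (x 0%N))) ->
  (diff2 h (t : nat -> R[i]^o) n : R[i]) = 2 * 'i / h%:C *
    ((z1 *: (toC (E (x n)))^T - z2 *: (toC (B (x 0%N)))^T)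
       *m diff1 h (fun j => toC (x j)) n) 0 0 ->
  real_recursion E B h x t sigma rho n.
Proof.
move=> n0 h0 -> -> xE tE; have hN : h != 0 by rewrite gt_eqF.
have two : 2 / h%:C = (2 / h)%:C :> R[i] by rewrite fmorph_div rmorph_nat.
split.
- move: xE; rewrite diff2_position // diff1_position // two.
  rewrite -!toCZ -toCD -toCM -toCZ -toCB.
  move/real_part_of_combination.
  rewrite (Re_Im_mul_imaginary _ _).1 diff1_time //.
  move/(congr1 (fun a => half_velocity h x n.-1 + h *: a)).
  rewrite scalerA divff // scale1r addrC subrK => ->; congr (_ + h *: _).
  rewrite -[RHS]scale1r -tildeE tilde_linear !mulmxDl -!scalemxAl.
  apply/colP => i; rewrite !mxE; field.
  done.
- move/(congr1 (@complex.Im R)): tE; rewrite diff2_time // diff1_position //.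
  rewrite -!toCT -!toCZ -toCB -!toCM (Re_Im_mul_imaginary _ _).2.
  rewrite mxE /= => /(congr1 (fun a => half_factor h t n.-1 + h * a)).
  rewrite mulrA divff // mul1r addrC subrK => ->; congr (_ + h * _).
  rewrite /dot !mxE mulr_sumr; apply: eq_bigr => j _; rewrite !mxE; field.
  done.
Qed.


Lemma real_momentum_of E B h x t w (s3 s4 : R) n (z3 z4 : R[i]) :
  (0 < n)%N -> z3 = s3%:C -> z4 = s4%:C ->
  w n = 'i * z4 * ((toC (E (x n)))^T *m toC (tilde (B (x n)))
                     *m diff1 h (fun j => toC (x j)) n) 0 0
    + (z3 + z4 * ((toC (E (x n)))^T *m toC (E (x n))) 0 0)
       * (diff1 h (t : nat -> R[i]^o) n : R[i]) ->
  real_momentum E B h x t w s3 s4 n.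
Proof.
move=> n0 -> -> wE; rewrite /real_momentum wE.
rewrite -mulmxA diff1_position // -toCM tildeE !toC_dot.
rewrite -!rmorphM -mulrA -!rmorphM -rmorphD ImD ImM_real diff1_time //.
by congr (_ + _); rewrite /= mul0r mul1r add0r.
Qed.

(** M2 has sigma = K1 / (h / 2), rho = K2 / (h / 2), s3 = K3, s4 = K4; M3 drops
    rho and s4; M4 has the limit values 1, 0, 1, 0.  The coefficients are taken
    at the fixed starting point, so that the constants do not depend on the
    numerical solution. *)
Lemma methods_in_real_form (m : method) (E0 B0 : 'cV[R]_3) :
  exists c h0 : R, 0 < h0 /\ forall h, 0 < h <= h0 ->
    exists sigma rho s3 s4 : R,
    [/\ `|sigma - 1| <= c * h ^+ 2, `|rho| <= c * h ^+ 2,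
        `|s3 - 1| <= c * h ^+ 2 & `|s4| <= c * h ^+ 2] /\
    forall E B x v t w n, E (x 0%N) = E0 -> B (x 0%N) = B0 -> (0 < n)%N ->
      recursion E B h x t m n -> momentum E B h x v t w m n ->
      real_recursion E B h x t sigma rho n /\
      real_momentum E B h x t w s3 s4 n.
Proof.
have [c1 [h1 [h1_gt0 K1c]]] := K1_O2 E0 B0.
have [c2 [h2 [h2_gt0 K2c]]] := K2_O2 E0 B0.
have [c3 [h3 [h3_gt0 K3c]]] := K3_O2 E0 B0.
have [c4 [h4 [h4_gt0 K4c]]] := K4_O2 E0 B0.
pose c := `|c1| + `|c2| + `|c3| + `|c4|.
exists c, (Num.min (Num.min h1 h2) (Num.min h3 h4)).
split; first by rewrite !lt_min h1_gt0 h2_gt0 h3_gt0.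
move=> h; rewrite !le_min => /andP[h0 /andP[/andP[hh1 hh2] /andP[hh3 hh4]]].
have [|a1 a1c K1E] := K1c h; first by rewrite h0.
have [|a2 a2c K2E] := K2c h; first by rewrite h0.
have [|a3 a3c K3E] := K3c h; first by rewrite h0.
have [|a4 a4c K4E] := K4c h; first by rewrite h0.
have le_c d : d \in [:: c1; c2; c3; c4] -> d * h ^+ 2 <= c * h ^+ 2.
  move=> dc; rewrite ler_wpM2r ?sqr_ge0 // /c.
  have := normr_ge0 c1; have := normr_ge0 c2.
  have := normr_ge0 c3; have := normr_ge0 c4.
  have := ler_norm d; move: dc; rewrite !inE => /or4P[] /eqP ->; lra.
have c_ge0 : 0 <= c * h ^+ 2 by rewrite mulr_ge0 ?sqr_ge0 // !addr_ge0.
have S1E : K1 h E0 B0 = (h / 2 * (1 + a1))%:C.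
  rewrite rmorphM rmorphD rmorph1 /= -K1E addrC subrK mulrC divfK //.
  exact: step_neq0.
have S2E : K2 h E0 B0 = (h / 2 * a2)%:C.
  by rewrite rmorphM /= -K2E mulrC divfK //; exact: step_neq0.
have S3E : K3 h E0 B0 = (1 + a3)%:C.
  by rewrite rmorphD rmorph1 /= -K3E addrC subrK.
have hC0 : h%:C != 0 by rewrite fmorph_eq0 gt_eqF.
have {}a1c : `|1 + a1 - 1| <= c * h ^+ 2.
  by rewrite addrC addKr (le_trans a1c) // le_c // !inE eqxx.
have {}a2c : `|a2| <= c * h ^+ 2.
  by rewrite (le_trans a2c) // le_c // !inE eqxx ?orbT.
have {}a3c : `|1 + a3 - 1| <= c * h ^+ 2.
  by rewrite addrC addKr (le_trans a3c) // le_c // !inE eqxx ?orbT.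
have {}a4c : `|a4| <= c * h ^+ 2.
  by rewrite (le_trans a4c) // le_c // !inE eqxx ?orbT.
have zero_c : `|0 : R| <= c * h ^+ 2 by rewrite normr0.
have one_c : `|1 - 1 : R| <= c * h ^+ 2 by rewrite subrr normr0.
have zeroC : 0 = (h / 2 * 0)%:C :> R[i] by rewrite mulr0.
have cancel_half : 2 / h%:C * (h / 2 * 1)%:C = 1.
  by rewrite mulr1 fmorph_div rmorph_nat mulrA divfK // divff.
case: m.
- exists (1 + a1), a2, (1 + a3), a4; split => // E B x v t w n EE BB n0 /=;
    subst E0 B0 => -[r1 r2] [_ p2].
  split; last exact: (real_momentum_of n0 _ K4E p2).
  exact: (real_recursion_of n0 h0 S1E S2E r1 r2).
- exists (1 + a1), 0, (1 + a3), 0; split => // E B x v t w n EE BB n0 /=;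
    subst E0 B0 => -[r1 r2] [_ p2].
  split.
  + apply: (real_recursion_of n0 h0 S1E zeroC).
    * by rewrite r1 !scale0r addr0 subr0 -scalemxAl scalerBr !scalerA; congr (_ - _ *: _); ring.
    * rewrite r2 !scale0r subr0 -scalemxAl [in RHS]mxE; ring.
  + apply: (real_momentum_of n0 S3E (z4 := 0)) => //.
    by rewrite p2 mulr0 !mul0r add0r addr0.
- exists 1, 0, 1, 0; split => // E B x v t w n EE BB n0 /=;
    subst E0 B0 => -[r1 r2] [_ p2].
  split.
  + apply: (real_recursion_of n0 h0 erefl zeroC).
    * rewrite r1 !scale0r addr0 subr0 -scalemxAl !scalerA cancel_half scale1r.
      congr (_ - _ *: _); rewrite -[LHS]mul1r -[X in X * _ = _]cancel_half;
        set z := (h / 2 * 1)%:C; ring.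
    * rewrite r2 !scale0r subr0 -scalemxAl [in RHS]mxE -[LHS]mul1r -[X in X * _ = _]cancel_half;
        set z := (h / 2 * 1)%:C; ring.
  + apply: (real_momentum_of n0 (z3 := 1) (z4 := 0)) => //.
    by rewrite p2 mulr0 !mul0r add0r addr0 mul1r.
Qed.

End RealForm.

(** * The first half step *)

Section StartingValue.
Context {R : realType}.

Lemma component_mulmx_bound (f : R[i] -> R) n (D : 'M[R[i]]_n) (p : 'cV[R[i]]_n) (d : R) i :
  (forall z1 z2, f (z1 + z2) = f z1 + f z2) -> f 0 = 0 ->
  (forall z1 z2, `|f (z1 * z2)| <=
     (`|complex.Re z1| + `|complex.Im z1|) * (`|complex.Re z2| + `|complex.Im z2|)) ->
  (forall j, `|complex.Re (D i j)| <= d /\ `|complex.Im (D i j)| <= d) ->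
  `|f ((D *m p) i 0)| <=
    2 * (\sum_j (`|complex.Re (p j 0)| + `|complex.Im (p j 0)|)) * d.
Proof.
move=> fD f0 fM Dd; rewrite mxE (big_morph f fD f0).
apply: (le_trans (ler_norm_sum _ _ _)).
rewrite (mulrC 2) -mulrA mulr_suml; apply: ler_sum => j _.
apply: (le_trans (fM _ _)); rewrite mulrC ler_wpM2l ?addr_ge0 //.
by have [] := Dd j; lra.
Qed.

Lemma expmx_apply_linearization n (M : 'M[R[i]]_n) (p : 'cV[R[i]]_n) :
  exists c : R, forall k : R, 0 <= k <= 1 -> forall i,
    `|complex.Re ((expmx (k%:C *: M) *m p) i 0)
      - (complex.Re (p i 0) + k * complex.Re ((M *m p) i 0))| <= c * k ^+ 2 /\
    `|complex.Im ((expmx (k%:C *: M) *m p) i 0)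
      - (complex.Im (p i 0) + k * complex.Im ((M *m p) i 0))| <= c * k ^+ 2.
Proof.
have [c Mc] := expmx_linearization M.
exists (2 * (\sum_j (`|complex.Re (p j 0)| + `|complex.Im (p j 0)|)) * c).
move=> k kI i; rewrite -(mulrA _ c).
have DE : (expmx (k%:C *: M) *m p) i 0 =
    ((expmx (k%:C *: M) - (1 + k%:C *: M)) *m p) i 0
    + (p i 0 + k%:C * (M *m p) i 0).
  rewrite mulmxBl mulmxDl mul1mx -scalemxAl [_ i 0 in RHS]mxE.
  by rewrite [X in _ + X + _]mxE [X in _ - X + _]mxE [X in _ - (_ + X) + _]mxE subrK.
split; rewrite DE.
- rewrite !ReD ReM_real addrK.
  apply: (component_mulmx_bound (f := @complex.Re R)) => //.
  + exact: ReD.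
  + case=> a1 b1 [a2 b2] /=; apply: (le_trans (ler_normB _ _)); rewrite !normrM.
    have := normr_ge0 a1; have := normr_ge0 b1; have := normr_ge0 a2; have := normr_ge0 b2.
    nra.
  + by move=> j; exact: Mc.
- rewrite !ImD ImM_real addrK.
  apply: (component_mulmx_bound (f := @complex.Im R)) => //.
  + exact: ImD.
  + case=> a1 b1 [a2 b2] /=; apply: (le_trans (ler_normD _ _)); rewrite !normrM.
    have := normr_ge0 a1; have := normr_ge0 b1; have := normr_ge0 a2; have := normr_ge0 b2.
    nra.
  + by move=> j; exact: Mc.
Qed.

(** The velocity of the first half step is needed to first order only, but the
    relativistic factor to second order: its term h / 2 * dot E0 v0 is what
    cancels the first-order change of the potential between x 0 and the
    midpoint of x 0 and x 1. *)
Lemma starting_value_expansion (E0 B0 v0 : 'cV[R]_3) (w0 : R[i]) :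
  exists2 c : R, 0 <= c & forall (E B : 'cV[R]_3 -> 'cV[R]_3) h x v t w,
    0 < h <= 1 -> E (x 0%N) = E0 -> B (x 0%N) = B0 -> v 0%N = v0 -> w 0%N = w0 ->
    starting_value E B h x v t w ->
    `|half_velocity h x 0 - v0| <= c * h /\
    `|half_factor h t 0 - (complex.Im w0 + h / 2 * dot E0 v0)| <= c * h ^+ 2.
Proof.
pose F : 'M[R[i]]_(3 + 1) :=
  block_mx (toC (tilde B0)) (- 'i *: toC E0) ('i *: (toC E0)^T) 0.
pose p := pair4 v0 w0.
have [c Fc] := expmx_apply_linearization F p.
pose d := `|c| + \sum_i `|complex.Re ((F *m p) i 0)|.
have d0 : 0 <= d by rewrite addr_ge0 // sumr_ge0.
exists d => // E B h x v t w /andP[h0 h1] EE BB vv ww.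
rewrite /starting_value /Fmx EE BB vv ww -/F -/p => start.
have hN : h != 0 by rewrite gt_eqF.
have kI : 0 <= h / 2 <= 1 by lra.
have cd : c * (h / 2) ^+ 2 <= `|c| * h ^+ 2.
  have := sqr_ge0 h; have := ler_norm c; have := normr_ge0 c.
  rewrite expr_div_n; nra.
have startC : col_mx (toC (half_velocity h x 0)) ((h^-1)%:C * (t 1%N - t 0%N))%:M
    = expmx ((h / 2)%:C *: F) *m p.
  have : pair4 (x 1%N) (t 1%N) - pair4 (x 0%N) (t 0%N) =
      h%:C *: (expmx ((h / 2)%:C *: F) *m p) by rewrite start addrC addKr.
  move=> /(congr1 (fun M => (h^-1)%:C *: M)).
  rewrite scalerA -rmorphM mulVf // rmorph1 scale1r => <-.
  rewrite /pair4 opp_col_mx add_col_mx scale_col_mx -toCB -toCZ.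
  by rewrite -raddfB /= scale_scalar_mx.
split.
- apply: norm_le_entries; first by rewrite mulr_ge0 // ltW.
  move=> i j; rewrite (ord1 j) [_ i 0]mxE [X in _ + X]mxE.
  have [+ _] := Fc (h / 2) kI (lshift 1 i).
  move: (F *m p) @d d0 cd => Fp d d0 cd.
  rewrite -startC !col_mxEu !mxE /= => bnd.
  have Fi : `|complex.Re (Fp (lshift 1 i) 0)| <= \sum_i `|complex.Re (Fp i 0)|.
    by rewrite (bigD1 (lshift 1 i)) //= lerDl sumr_ge0.
  have hF : `|h * complex.Re (Fp (lshift 1 i) 0)|
      <= h * \sum_i `|complex.Re (Fp i 0)|.
    by rewrite normrM (gtr0_norm h0) ler_wpM2l // ltW.
  have hc : `|c| * h ^+ 2 <= `|c| * h.
    by rewrite ler_wpM2l // expr2 ler_piMl // ltW.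
  have dE : d * h = `|c| * h + h * \sum_i `|complex.Re (Fp i 0)|.
    by rewrite /d; ring.
  move: bnd hF; rewrite dE !ler_norml; lra.
- have [_ +] := Fc (h / 2) kI (rshift 3 0).
  have -> : (F *m p) (rshift 3 0) 0 = 'i * (dot E0 v0)%:C.
    rewrite mul_block_col col_mxEd mul0mx addr0 -scalemxAl mxE.
    by rewrite toC_dot.
  have cd2 : c * (h / 2) ^+ 2 <= d * h ^+ 2.
    apply: (le_trans cd); rewrite ler_wpM2r ?sqr_ge0 // /d lerDl.
    by rewrite sumr_ge0.
  rewrite -startC !col_mxEd !mxE /= !mulr1n ImM_real => bnd.
  apply: le_trans cd2; move: bnd.
  by rewrite /half_factor mul0r mul1r add0r.
Qed.

End StartingValue.

(** * The fields and their bounds on a compact set *)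

Section Fields.
Context {R : realType}.

Lemma affine_cvg (a d : R) : a + k * d @[k --> 0^'] --> a.
Proof.
rewrite -[X in _ --> X]addr0 -[X in _ + X](mul0r d).
apply: cvgD; first exact: cvg_cst.
apply: cvgM; last exact: cvg_cst.
by move=> S S0; apply: cvg_within.
Qed.

(** The difference quotient along an axis is an affine function of the
    increment, hence its limit is read off directly. *)
Lemma grad_quadratic_potential (Q : 'M[R]_3) q y : Q^T = Q ->
  grad (quadratic_potential Q q) y = Q *m y + q.
Proof.
move=> QT; apply/colP => j; rewrite mxE /partial /derive.
have dot_ax a : dot a (ax j) = a j 0.
  rewrite dotE !mxE.
  by case: j => -[|[|[|//]]] jlt /=; rewrite ?(mulr1, mulr0, addr0, add0r);
    congr (a _ 0); apply/val_inj.
apply: cvg_lim => //.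
rewrite [X in X @ _](_ : _ = (fun h : R => h^-1 * (h * ((Q *m y + q) j 0
    + h * (2^-1 * dot (ax j) (Q *m ax j)))))); last first.
  apply/funext => h; congr (_ * _); rewrite /= !quadratic_potentialE.
  rewrite mulmxDr -scalemxAr !dot_linear -dot_ax dotDl (dotC (ax j) (Q *m y)).
  rewrite (dot_symmetric y (ax j) QT) (dotC (ax j) (Q *m y)).
  by field.
apply: (@cvg_trans _ ((fun h : R => (Q *m y + q) j 0
    + h * (2^-1 * dot (ax j) (Q *m ax j))) @ 0^')).
  apply: near_eq_cvg; near=> h; rewrite mulKf //.
  by near: h; exact: nbhs_dnbhs_neq.
exact: affine_cvg.
Unshelve. all: by end_near.
Qed.

Lemma continuous_bounded_on_compact (f : 'cV[R]_3 -> R) (K : set 'cV[R]_3) :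
  compact K -> continuous f -> exists M : R, forall y, K y -> `|f y| <= M.
Proof.
move=> cK cf.
have /compact_bounded[M [_ fM]] : compact (f @` K).
  by apply: continuous_compact => //; exact: continuous_subspaceT.
exists (M + 1) => y Ky; apply: (fM (M + 1)); first by rewrite ltrDl.
by exists y.
Qed.

Lemma curl_bounded_on_compact (A : 'cV[R]_3 -> 'cV[R]_3) (K : set 'cV[R]_3) :
  compact K -> smooth A -> exists M : R, forall y, K y -> `|curl A y| <= M.
Proof.
move=> cK sA.
have bnd ji : exists M : R, forall y, K y ->
    `|partial ji.1 (fun y => A y ji.2 0) y| <= M.
  apply: continuous_bounded_on_compact => //.
  by have [_ _ /(_ ji.1)] := sA ji.2 1%N.
have [M AM] := choice bnd.
pose s := \sum_(ji : 'I_3 * 'I_3) `|M ji|.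
have As j i y : K y -> `|partial j (fun y => A y i 0) y| <= s.
  move=> Ky; apply: (le_trans (AM (j, i) y Ky)); apply: (le_trans (ler_norm _)).
  by rewrite /s (bigD1 (j, i)) //= lerDl sumr_ge0.
exists (2 * s) => y Ky; apply: norm_le_entries.
  by rewrite mulr_ge0 // sumr_ge0.
have AB j i j' i' : `|partial j (fun y => A y i 0) y
                      - partial j' (fun y => A y i' 0) y| <= 2 * s.
  by apply: (le_trans (ler_normB _ _)); have := As j i y Ky; have := As j' i' y Ky; lra.
by move=> i j; rewrite mxE; case: i => -[|[|[|//]]] /= ?; exact: AB.
Qed.

End Fields.

(** * The perturbation of the energy *)

Section EnergyDrift.
Context {R : realType}.
Context (Q : 'M[R]_3) (q b0 : 'cV[R]_3) (c d h sigma rho : R).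
Context (c1 : 1 <= c) (d0 : 0 <= d).
Context (Qc : `|Q| <= c) (qc : `|q| <= c) (b0c : `|b0| <= c).
Context (sigma_d : `|sigma - 1| <= d * h ^+ 2) (rho_d : `|rho| <= d * h ^+ 2).

Let Q' : 'M[R]_3 := sigma *: Q.
Let q' : 'cV[R]_3 := sigma *: q + rho *: b0.

(** Identifies the electric field of the real recursion with the force of the
    perturbed potential, to which the invariants apply. *)
Lemma force_perturbed a : force Q' q' a = sigma *: force Q q a - rho *: b0.
Proof.
rewrite /force /Q' /q' -scalemxAl; apply/colP => i; rewrite !mxE; ring.
Qed.

Lemma potential_perturbation a : `|a| <= c ->
  `|quadratic_potential Q' q' a - quadratic_potential Q q a|
    <= d * h ^+ 2 * (11 * c ^+ 3).
Proof.
move=> ac.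
have -> : quadratic_potential Q' q' a - quadratic_potential Q q a =
    (sigma - 1) * polarized_potential Q q a a + rho * dot b0 a.
  rewrite /polarized_potential !quadratic_potentialE /Q' /q' -scalemxAl.
  by rewrite !dot_linear; field.
have c0 : 0 <= c by apply: le_trans c1.
have c3 : c ^+ 2 <= c ^+ 3 by rewrite exprS ler_peMl // sqr_ge0.
apply: (le_trans (ler_normD _ _)); rewrite (normrM (sigma - 1)) (normrM rho).
have Ua := norm_polarized_potential_le c1 Qc qc ac ac.
have ba : `|dot b0 a| <= 3 * c * c.
  by apply: (le_trans (norm_dot_le _ _)); rewrite ler_pM ?mulr_ge0 // ler_wpM2l.
have e1 := ler_pM (normr_ge0 _) (normr_ge0 _) sigma_d Ua.
have e2 := ler_pM (normr_ge0 _) (normr_ge0 _) rho_d ba.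
have : d * h ^+ 2 * c ^+ 2 <= d * h ^+ 2 * c ^+ 3.
  by rewrite ler_wpM2l // mulr_ge0 // sqr_ge0.
lra.
Qed.

(** Between a0 and a0 + h u0 the polarized potential is that of a0 minus
    h / 2 * dot (force a0) u0, and g0 exceeds gamma0 by h / 2 * dot (force a0) v0
    up to O(h^2); as u0 - v0 = O(h), the two cancel to second order. *)
Lemma initial_energy_perturbation (a0 u0 v0 : 'cV[R]_3) (g0 gamma0 : R) :
  Q^T = Q -> 0 < h <= 1 -> `|a0| <= c -> `|u0| <= c ->
  `|u0 - v0| <= d * h ->
  `|g0 - (gamma0 + h / 2 * dot (force Q q a0) v0)| <= d * h ^+ 2 ->
  `|g0 + polarized_potential Q' q' a0 (a0 + h *: u0)
    - (gamma0 + quadratic_potential Q q a0)| <= d * h ^+ 2 * (26 * c ^+ 3).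
Proof.
move=> QT /andP[h0 h1] a0c u0c u0v0 g0c.
have Q'T : Q'^T = Q' by rewrite /Q' linearZ /= QT.
rewrite polarized_potential_step // force_perturbed.
have := potential_perturbation a0c.
set U' := quadratic_potential Q' q' a0; set U := quadratic_potential Q q a0.
set e := force Q q a0 in g0c *; move=> UU.
have c0 : 0 <= c by apply: le_trans c1.
have c13 : 1 <= c ^+ 3 by rewrite exprn_ege1.
have c3 : c ^+ 2 <= c ^+ 3 by rewrite exprS ler_peMl // sqr_ge0.
have ec : `|e| <= 4 * c ^+ 2 by exact: norm_force_le.
have dh2 : 0 <= d * h ^+ 2 by rewrite mulr_ge0 // sqr_ge0.
have d1 : `|dot e (u0 - v0)| <= 3 * (4 * c ^+ 2) * (d * h).
  by apply: (le_trans (norm_dot_le _ _)); rewrite ler_pM ?mulr_ge0 // ler_wpM2l.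
have d2 : `|(sigma - 1) * dot e u0| <= d * h ^+ 2 * (3 * (4 * c ^+ 2) * c).
  rewrite normrM ler_pM //; apply: (le_trans (norm_dot_le _ _)).
  by rewrite ler_pM ?mulr_ge0 // ler_wpM2l.
have d3 : `|rho * dot b0 u0| <= d * h ^+ 2 * (3 * c * c).
  rewrite normrM ler_pM //; apply: (le_trans (norm_dot_le _ _)).
  by rewrite ler_pM ?mulr_ge0 // ler_wpM2l.
have -> : g0 + (U' - 2^-1 * dot (sigma *: e - rho *: b0) (h *: u0)) - (gamma0 + U) =
    (g0 - (gamma0 + h / 2 * dot e v0)) + (U' - U)
    - h / 2 * (dot e (u0 - v0) + (sigma - 1) * dot e u0 - rho * dot b0 u0).
  by rewrite !(dotDl, dotDr, dotZl, dotZr, dotNl, dotNr); field.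
set y := dot e (u0 - v0) in d1 *; set y2 := (sigma - 1) * _ in d2 *.
set y3 := rho * _ in d3 *.
have hy : `|h / 2 * (y + y2 - y3)| <= 1 / 2 * (d * h ^+ 2) *
    (12 * c ^+ 2 + 12 * c ^+ 3 + 3 * c ^+ 2).
  have yy : `|y + y2 - y3| <= 3 * (4 * c ^+ 2) * (d * h)
      + d * h ^+ 2 * (3 * (4 * c ^+ 2) * c) + d * h ^+ 2 * (3 * c * c).
    by move: d1 d2 d3; rewrite !ler_norml; lra.
  have h20 : 0 <= h / 2 by rewrite divr_ge0 // ltW.
  rewrite normrM ger0_norm //; apply: (le_trans (ler_wpM2l h20 yy)).
  have k2 : h * (d * h ^+ 2 * c ^+ 3) <= d * h ^+ 2 * c ^+ 3.
    by rewrite ler_piMl // mulr_ge0 // exprn_ge0.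
  have k3 : h * (d * h ^+ 2 * c ^+ 2) <= d * h ^+ 2 * c ^+ 2.
    by rewrite ler_piMl // mulr_ge0 // exprn_ge0.
  lra.
have k4 : d * h ^+ 2 * c ^+ 2 <= d * h ^+ 2 * c ^+ 3 by rewrite ler_wpM2l.
have k5 : d * h ^+ 2 * 1 <= d * h ^+ 2 * c ^+ 3 by rewrite ler_wpM2l.
apply: (le_trans (ler_normB _ _)).
have := ler_normD (g0 - (gamma0 + h / 2 * dot e v0)) (U' - U).
lra.
Qed.

Lemma momentum_perturbation (e b u : 'cV[R]_3) (s3 s4 g : R) :
  `|s3 - 1| <= d * h ^+ 2 -> `|s4| <= d * h ^+ 2 ->
  `|e| <= 4 * c ^+ 2 -> `|b| <= c ->
  `|u| <= 74 * c ^+ 3 -> `|g| <= 74 * c ^+ 3 ->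
  `|s4 * dot e (cross u b) + (s3 + s4 * dot e e) * g - g|
    <= d * h ^+ 2 * (5402 * c ^+ 7).
Proof.
move=> s3d s4d ec bc uc gc.
have c0 : 0 <= c by apply: le_trans c1.
have c37 : c ^+ 3 <= c ^+ 7 by rewrite ler_weXn2l.
have c67 : c ^+ 6 <= c ^+ 7 by rewrite ler_weXn2l.
have dh2 : 0 <= d * h ^+ 2 by rewrite mulr_ge0 // sqr_ge0.
have e1 : `|dot e (cross u b)| <= 3 * (4 * c ^+ 2) * (2 * (74 * c ^+ 3) * c).
  apply: (le_trans (norm_dot_le _ _)); rewrite ler_pM ?mulr_ge0 ?ler_wpM2l //.
  by apply: (le_trans (norm_cross_le _ _)); rewrite ler_pM ?mulr_ge0 ?ler_wpM2l.
have e2 : `|dot e e| <= 3 * (4 * c ^+ 2) * (4 * c ^+ 2).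
  by apply: (le_trans (norm_dot_le _ _)); rewrite ler_pM ?mulr_ge0 ?ler_wpM2l.
have e3 : `|dot e e * g| <= 3 * (4 * c ^+ 2) * (4 * c ^+ 2) * (74 * c ^+ 3).
  by rewrite normrM ler_pM.
have -> : s4 * dot e (cross u b) + (s3 + s4 * dot e e) * g - g =
  s4 * dot e (cross u b) + (s3 - 1) * g + s4 * (dot e e * g) by ring.
have f1 := ler_pM (normr_ge0 _) (normr_ge0 _) s4d e1.
have f2 := ler_pM (normr_ge0 _) (normr_ge0 _) s3d gc.
have f3 := ler_pM (normr_ge0 _) (normr_ge0 _) s4d e3.
rewrite -normrM in f1; rewrite -normrM in f2; rewrite -normrM in f3.
have k1 : d * h ^+ 2 * c ^+ 3 <= d * h ^+ 2 * c ^+ 7 by rewrite ler_wpM2l.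
have k2 : d * h ^+ 2 * c ^+ 6 <= d * h ^+ 2 * c ^+ 7 by rewrite ler_wpM2l.
have := ler_normD (s4 * dot e (cross u b) + (s3 - 1) * g) (s4 * (dot e e * g)).
have := ler_normD (s4 * dot e (cross u b)) ((s3 - 1) * g).
lra.
Qed.

End EnergyDrift.

(** * Near-conservation of the energy *)

Theorem theorem2 (R : realType) (A : 'cV[R]_3 -> 'cV[R]_3)
    (Q : 'M[R]_3) (q : 'cV[R]_3)
    (x0 v0 : 'cV[R]_3) (t0 w0 : R[i])
    (K : set 'cV[R]_3) (N : nat) (m : method) :
  let U := quadratic_potential Q q in
  let E := fun y => - grad U y in
  let B := curl A in
  smooth A -> Q^T = Q ->
  complex.Re t0 = 0 -> complex.Re w0 = 0 ->
  compact K -> (3 <= N)%N ->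
  exists C h0 : R, 0 < h0 /\
    forall (h : R) (x v : nat -> 'cV[R]_3) (t w : nat -> R[i])
           (gamma : nat -> R),
      0 < h <= h0 ->
      x 0%N = x0 -> t 0%N = t0 -> v 0%N = v0 -> w 0%N = w0 ->
      let T := h ^ (- N%:Z + 2) in
      numerical_solution E B h x v t w m T ->
      (forall n : nat, n%:R * h <= T -> w n = 'i * (gamma n)%:C) ->
      (forall n : nat, n%:R * h <= T -> x n \in K) ->
      forall n : nat, n%:R * h <= T ->
        `|energy U (x n) (gamma n) - energy U (x 0%N) (gamma 0%N)|
          <= C * h ^+ 2.
Proof.
move=> U E B sA QT _ _ cK _.
have EE y : E y = force Q q y by rewrite /E grad_quadratic_potential.
have [M KM] : exists M : R, forall y, K y -> `|y| <= M.
  have /compact_bounded[M [_ KM]] := cK.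
  by exists (M + 1) => y Ky; apply: (KM (M + 1)) => //; rewrite ltrDl.
have [MB KB] := curl_bounded_on_compact cK sA.
have [c1 [h1 [h1_gt0 real_form]]] := methods_in_real_form m (E x0) (B x0).
have [c2 c2_ge0 start] := starting_value_expansion (E x0) (B x0) v0 w0.
pose d := `|c1| + c2.
have d0 : 0 <= d by rewrite addr_ge0.
(* One bound for all the data, also of the perturbed potential, with
   |sigma| <= 2 and |rho| <= 1. *)
pose c := 1 + `|M| + 2 * `|Q| + 2 * `|q| + `|B x0| + 2 * `|MB|
  + 3 * `|Q| * `|M| + `|v0| + `|complex.Im w0| + `|dot (E x0) v0| + 2 * c2.
have [c_ge1 Mc Qc qc B0c] :
    [/\ 1 <= c, `|M| <= c, `|Q| <= c, `|q| <= c & `|B x0| <= c].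
  have := mulr_ge0 (normr_ge0 Q) (normr_ge0 M).
  have [M0 Q0 q0 B00] := And4 (normr_ge0 M) (normr_ge0 Q) (normr_ge0 q) (normr_ge0 (B x0)).
  have [MB0 v00 w00 Ev0] := And4 (normr_ge0 MB) (normr_ge0 v0)
    (normr_ge0 (complex.Im w0)) (normr_ge0 (dot (E x0) v0)).
  by rewrite /c; split; lra.
have [Qc2 qBc MBc vc wc] : [/\ 2 * `|Q| <= c, 2 * `|q| + `|B x0| <= c,
    2 * `|MB| + (3 * `|Q| * `|M| + `|q|) <= c, `|v0| + c2 <= c &
    `|complex.Im w0| + `|dot (E x0) v0| + c2 <= c].
  have := mulr_ge0 (normr_ge0 Q) (normr_ge0 M).
  have [M0 Q0 q0 B00] := And4 (normr_ge0 M) (normr_ge0 Q) (normr_ge0 q) (normr_ge0 (B x0)).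
  have [MB0 v00 w00 Ev0] := And4 (normr_ge0 MB) (normr_ge0 v0)
    (normr_ge0 (complex.Im w0)) (normr_ge0 (dot (E x0) v0)).
  by rewrite /c; split; lra.
have [c1d c2d] : c1 <= d /\ c2 <= d.
  by have := ler_norm c1; have := normr_ge0 c1; rewrite /d; split; lra.
clearbody c d.
have c2_gt0 : 0 < 14 * c ^+ 2 by rewrite mulr_gt0 // exprn_gt0 // (lt_le_trans ltr01).
have c2_ge14 : 14 <= 14 * c ^+ 2 by rewrite ler_peMr // exprn_ege1.
exists (d * (5402 * c ^+ 7 + 11 * c ^+ 3 + 26 * c ^+ 3) + 1332 * c ^+ 7).
(* h <= 1 comes from the second bound, and d h^2 <= 1 from it and the third. *)
exists (Num.min h1 (Num.min (14 * c ^+ 2)^-1 (1 + d)^-1)).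
split; first by rewrite !lt_min h1_gt0 !invr_gt0 c2_gt0 /= ltr_wpDr.
move=> h x v t w gamma; rewrite !le_min => /andP[h_gt0 /and3P[hh1 hc hd]].
move=> x00 t00 v00' w00' T [starting solves] wE xK n nT.
have h_le1 : h <= 1.
  apply: (le_trans hc); rewrite invf_le1 //; lra.
have hI : 0 < h <= 1 by rewrite h_gt0.
have {}hc : h * (14 * c ^+ 2) <= 1 by rewrite -ler_pdivlMr // div1r.
have dh1 : d * h ^+ 2 <= 1.
  have : h * (1 + d) <= 1 by rewrite -ler_pdivlMr ?div1r // ltr_wpDr.
  have : d * h ^+ 2 <= d * h by rewrite ler_wpM2l // expr2 ler_piMl // ltW.
  lra.
have h20 : 0 <= h ^+ 2 by exact: sqr_ge0.
have jT j : (j <= n)%N -> j%:R * h <= T.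
  by move=> jn; apply: le_trans nT; rewrite ler_wpM2r ?ler_nat // ltW.
have Xc j : (j <= n)%N -> `|x j| <= `|M|.
  move=> jn; have := xK j (jT j jn); rewrite inE => /KM /le_trans; apply.
  exact: ler_norm.
have gammaE j : (j <= n)%N -> gamma j = complex.Im (w j).
  by move=> /jT /wE -> /=; rewrite mul0r mul1r add0r.
have [n0|n_gt0] := posnP n.
  rewrite n0 subrr normr0; apply: (mulr_ge0 _ h20).
  have c7 : 0 <= c ^+ 7 by rewrite exprn_ge0 // (le_trans ler01).
  have c3 : 0 <= c ^+ 3 by rewrite exprn_ge0 // (le_trans ler01).
  have := mulr_ge0 d0 c7; have := mulr_ge0 d0 c3; lra.
have [|sigma [rho [s3 [s4 [[sigma_c rho_c s3_c s4_c] scheme]]]]] := real_form h.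
  by rewrite h_gt0.
have le_d a : a <= c1 * h ^+ 2 -> a <= d * h ^+ 2.
  by move=> /le_trans; apply; rewrite ler_wpM2r.
have {sigma_c}sigma_d := le_d _ sigma_c; have {rho_c}rho_d := le_d _ rho_c.
have {s3_c}s3_d := le_d _ s3_c; have {s4_c}s4_d := le_d _ s4_c.
pose u := half_velocity h x; pose g := half_factor h t.
pose Q' : 'M[R]_3 := sigma *: Q; pose q' : 'cV[R]_3 := sigma *: q + rho *: B x0.
pose b j : 'cV[R]_3 := sigma *: B (x j) + rho *: E (x j).
have Q'T : Q'^T = Q' by rewrite /Q' linearZ /= QT.
have Xu j : x j.+1 = x j + h *: u j.
  by rewrite /u /half_velocity scalerA divff ?gt_eqF // scale1r addrC subrK.
have step j : (j < n)%N -> implicit_midpoint h Q' q' b x u g j.+1.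
  move=> jn; have [rec mom] := solves j.+1 isT (jT _ jn).
  have [[uE gE] _] := scheme E B x v t w j.+1 (congr1 E x00) (congr1 B x00) isT rec mom.
  have fE : force Q' q' (x j.+1) = sigma *: E (x j.+1) - rho *: B (x 0%N).
    by rewrite /Q' /q' force_perturbed -EE x00.
  by rewrite /implicit_midpoint fE; split.
have gamma_nE : gamma n = s4 * dot (E (x n)) (cross (mid_velocity u n) (B (x n)))
    + (s3 + s4 * dot (E (x n)) (E (x n))) * mid_factor g n.
  have [rec mom] := solves n n_gt0 nT.
  have [_] := scheme E B x v t w n (congr1 E x00) (congr1 B x00) n_gt0 rec mom.
  by rewrite gammaE.
have [u0v0 g0w0] := start E B h x v t w hI (congr1 E x00) (congr1 B x00) v00' w00' starting.
have sigma2 : `|sigma| <= 2.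
  have -> : sigma = (sigma - 1) + 1 by rewrite subrK.
  by apply: (le_trans (ler_normD _ _)); rewrite normr1; lra.
have rho1 : `|rho| <= 1 by exact: le_trans dh1.
have Q'c : `|Q'| <= c.
  by rewrite normrZ; apply: le_trans Qc2; rewrite ler_wpM2r.
have q'c : `|q'| <= c.
  apply: (le_trans (ler_normD _ _)); rewrite !normrZ; apply: le_trans qBc.
  by rewrite lerD ?ler_wpM2r // ler_piMl.
have Bn : `|B (x n)| <= `|MB|.
  have := xK n nT; rewrite inE => /KB /le_trans; apply; exact: ler_norm.
have bc : `|b n| <= c.
  apply: (le_trans (ler_normD _ _)); rewrite !normrZ EE /force normrN.
  apply: le_trans MBc; rewrite lerD ?ler_pM // -[leRHS]mul1r ler_pM //.
  apply: (le_trans (ler_normD _ _)); rewrite lerD //.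
  apply: (le_trans (norm_mulmx_le _ _)).
  by rewrite ler_wpM2l ?mulr_ge0 // Xc.
have c2h : c2 * h <= c2 by rewrite ler_piMr.
have c2h2 : c2 * h ^+ 2 <= c2 by rewrite ler_piMr // exprn_ile1 // ltW.
have u0c : `|u 0%N| <= c.
  rewrite -(subrK v0 (u 0%N)) addrC; apply: (le_trans (ler_normD _ _)).
  by apply: le_trans vc; rewrite lerD // (le_trans u0v0).
have g0c : `|g 0%N| <= c.
  pose z := complex.Im w0 + h / 2 * dot (E x0) v0.
  have zc : `|z| <= `|complex.Im w0| + `|dot (E x0) v0|.
    apply: (le_trans (ler_normD _ _)); rewrite lerD // normrM ler_piMl //.
    rewrite ger0_norm; last by rewrite divr_ge0 // ltW.
    by rewrite ler_pdivrMr // mul1r (le_trans h_le1) // ler1n.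
  rewrite -(subrK z (g 0%N)) addrC; apply: (le_trans (ler_normD _ _)).
  by apply: le_trans wc; rewrite lerD // (le_trans g0w0).
have gamma0E : gamma 0%N = complex.Im w0 by rewrite gammaE // w00'.
have [ub gb drift] := velocity_and_energy_bounds Q'T Xu step c_ge1 n_gt0 h_gt0 hc
  Q'c q'c bc u0c g0c (fun j jn => le_trans (Xc j jn) Mc).
have xnc : `|x n| <= c := le_trans (Xc n (leqnn n)) Mc.
have x0c : `|x0| <= c by rewrite -x00; exact: le_trans (Xc 0%N (leq0n n)) Mc.
have Ec : `|E (x n)| <= 4 * c ^+ 2 by rewrite EE; exact: norm_force_le.
have Bc : `|B (x n)| <= c.
  apply: (le_trans Bn); apply: le_trans MBc.
  by rewrite mulr_natl mulr2n -addrA lerDl !addr_ge0 // !mulr_ge0.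
have momentum_drift := momentum_perturbation c_ge1 d0 s3_d s4_d Ec Bc ub gb.
rewrite -gamma_nE in momentum_drift.
have final_drift := potential_perturbation c_ge1 d0 Qc qc B0c sigma_d rho_d xnc.
have u0v0d : `|u 0%N - v0| <= d * h.
  by apply: (le_trans u0v0); rewrite ler_wpM2r // ltW.
have g0d : `|g 0%N - (complex.Im w0 + h / 2 * dot (force Q q x0) v0)| <= d * h ^+ 2.
  by rewrite -EE; apply: (le_trans g0w0); rewrite ler_wpM2r.
have initial_drift := initial_energy_perturbation c_ge1 d0 Qc qc B0c sigma_d rho_d
  QT hI x0c u0c u0v0d g0d.
have x1E : x 1%N = x0 + h *: u 0%N by rewrite Xu x00.
rewrite -x1E in initial_drift.
rewrite /energy gamma0E x00.
move: momentum_drift final_drift initial_drift drift.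
rewrite x00 -!/Q' -!/q' -!/U.
move: (gamma n) (mid_factor g n) (quadratic_potential Q' q' (x n)) (U (x n)) (U x0)
  (g 0%N) (polarized_potential _ _ _ _) (complex.Im w0) (c ^+ 7) (c ^+ 3) (h ^+ 2).
clear => gn mn U'n Un U0 g0 P0 w0 c7 c3 h2; rewrite !ler_norml.
lra.
Qed.
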